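(* For every positive integer $\ell$, \[ \operatorname{trdeg}_{\bar k}\bar k\big(\Gamma_{\mathrm{ari},v}(z)\ \big|\ z\in\mathbb{Q},\ (q^\ell-1)z\in\mathbb{Z}\big)\leq\ell-\gcd(\ell,\deg v). \]
   Context: $q$ is a power of a prime $p$, $A=\mathbb{F}_q[\theta]$, $k=\mathbb{F}_q(\theta)$, $v\in A$ monic irreducible, $k_v$ the completion of $k$ at $v$, $\mathbb{C}_v$ the completion of an algebraic closure of $k_v$, $\bar k$ the algebraic closure of $k$ in $\mathbb{C}_v$. For $i\ge0$, $D_{i,v}$ is the product of all monic polynomials of degree $i$ in $A$ not divisible by $v$. For $z\in\mathbb{Z}_p$ with $q$-adic expansion $z=\sum_{i\ge0}z_iq^i$ ($0\le z_i<q$), $\Gamma_{\mathrm{ari},v}(z+1)=\prod_{i\ge0}(-D_{i,v})^{z_i}\in k_v^\times$ (convergent), defining $\Gamma_{\mathrm{ari},v}:\mathbb{Z}_p\to k_v^\times$. *)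

(* Defs.v *)
From HB Require Import structures.
From mathcomp Require Import all_boot all_order all_algebra.
From mathcomp Require Import boolp classical_sets reals.
From mathcomp Require Import -(notations) mpoly.

Set Implicit Arguments.
Unset Strict Implicit.
Unset Printing Implicit Defensive.

Import Order.TTheory GRing.Theory Num.Theory.
Local Open Scope ring_scope.

(* Real-valued non-archimedean absolute values on fields.  MathComp's
   normedZmodType cannot be used: it requires `|x *+ n| = `|x| *+ n, which
   fails for the ultrametric absolute values below. *)
Section AbsoluteValues.
Variable R : realType.

Definition is_na_absval (K : fieldType) (abs : K -> R) : Prop :=
  [/\ forall x, 0 <= abs x,
      forall x, (abs x == 0) = (x == 0),
      forall x y, abs (x * y) = abs x * abs y
    & forall x y, abs (x + y) <= Num.max (abs x) (abs y)].

Definition abs_lim (K : fieldType) (abs : K -> R) (u : nat -> K) (l : K) :=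
  forall eps : R, 0 < eps ->
    exists N, forall n, (N <= n)%N -> abs (u n - l) < eps.

Definition abs_cauchy (K : fieldType) (abs : K -> R) (u : nat -> K) :=
  forall eps : R, 0 < eps ->
    exists N, forall m n, (N <= m)%N -> (N <= n)%N -> abs (u m - u n) < eps.

Definition abs_complete (K : fieldType) (abs : K -> R) :=
  forall u : nat -> K, abs_cauchy abs u -> exists l, abs_lim abs u l.

(* i exhibits (L, absL) as the completion of (K, absK). *)
Definition is_completion (K L : fieldType) (absK : K -> R) (absL : L -> R)
    (i : {rmorphism K -> L}) : Prop :=
  [/\ is_na_absval absL,
      forall x, absL (i x) = absK x,
      abs_complete absL
    & forall (y : L) (eps : R), 0 < eps -> exists x, absL (y - i x) < eps].

End AbsoluteValues.

Definition is_alg_closure (K L : fieldType) (i : {rmorphism K -> L}) : Prop :=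
  GRing.closed_field_axiom L /\ forall x : L, algebraicOver i x.

(* A = {poly F} with theta = 'X, and k = {fraction {poly F}}. *)
Section Places.
Variables (F : finFieldType) (v : {poly F}).

Definition pdeg (a : {poly F}) : nat := (size a).-1.

Definition ordv (a : {poly F}) : nat :=
  \max_(n < size a | v ^+ n %| a) n.

(* The v-adic absolute value of k, normalized by |v| = #|A / v|^-1. *)
Definition absv (R : realType) (x : {fraction {poly F}}) : R :=
  if x == 0 then 0
  else let c : R := #|F|%:R ^+ pdeg v in
       c ^+ ordv (\d_(repr x)) / c ^+ ordv (\n_(repr x)).

(* k -> k_v -> (algebraic closure of k_v) -> C_v.  These data are unique up
   to isometric isomorphism over k. *)
Record vadic_tower (R : realType) := VadicTower {
  kv : fieldType;
  kv_abs : kv -> R;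
  kv_in : {rmorphism {fraction {poly F}} -> kv};
  kv_completion : is_completion (absv R) kv_abs kv_in;

  kvbar : fieldType;
  kvbar_abs : kvbar -> R;
  kvbar_in : {rmorphism kv -> kvbar};
  kvbar_closure : is_alg_closure kvbar_in;
  kvbar_absval : is_na_absval kvbar_abs;
  kvbar_extends : forall x, kvbar_abs (kvbar_in x) = kv_abs x;

  Cv : fieldType;
  Cv_abs : Cv -> R;
  Cv_in : {rmorphism kvbar -> Cv};
  Cv_completion : is_completion kvbar_abs Cv_abs Cv_in
}.

Definition kv_to_Cv (R : realType) (T : vadic_tower R) (x : kv T) : Cv T :=
  Cv_in T (kvbar_in T x).

Definition k_to_Cv (R : realType) (T : vadic_tower R)
    (x : {fraction {poly F}}) : Cv T :=
  kv_to_Cv (kv_in T x).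

(* The algebraic closure of k inside C_v. *)
Definition kbar (R : realType) (T : vadic_tower R) : {pred Cv T} :=
  fun x => `[< algebraicOver (@k_to_Cv R T) x >].

Definition Dv (i : nat) : {poly F} :=
  \prod_(a : {poly_i.+1 F} |
          [&& (a : {poly F}) \is monic, pdeg a == i & ~~ (v %| (a : {poly F}))])
    (a : {poly F}).

End Places.

Arguments kbar {F v R} T _.

(* The ring Z_p as the inverse limit of the Z/p^n; each class is given by its
   representative in [0, p^n). *)
Record padic_int (p : nat) := PadicInt {
  padic_mod :> nat -> nat;
  padic_modP : forall n, padic_mod n = (padic_mod n.+1 %% p ^ n)%N
}.

Section PadicIntegers.
Variable p : nat.

Definition padic_pred_seq (x : padic_int p) (n : nat) : nat :=
  ((x n + (p ^ n).-1) %% p ^ n)%N.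

Lemma padic_pred_seqP (x : padic_int p) (n : nat) :
  padic_pred_seq x n = (padic_pred_seq x n.+1 %% p ^ n)%N.
Proof.
rewrite /padic_pred_seq; case: (posnP p) => [p0|p_gt0].
  case: n => [|n]; first by rewrite expn0 !modn1.
  have pS m : (p ^ m.+1 = 0)%N by rewrite p0 exp0n.
  by rewrite (padic_modP x n.+1) !pS !modn0.
have pn m : (0 < p ^ m)%N by rewrite expn_gt0 p_gt0.
rewrite modn_dvdm ?dvdn_exp2l // (padic_modP x n) modnDml.
apply/eqP; rewrite eqn_modDl -(eqn_modDr 1) !addn1 !prednK //.
by rewrite expnS modnMl modnn.
Qed.

(* x - 1 *)
Definition padic_pred (x : padic_int p) : padic_int p :=
  PadicInt (padic_pred_seqP x).

(* The image of z in Z/p^n: the numerator of z times the Bezout inverse of its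
   denominator.  The value when p divides the denominator is irrelevant. *)
Definition padic_of_rat_seq (z : rat) (n : nat) : nat :=
  if coprime p `|denq z|
  then `|((numq z * (egcdz (denq z) (p ^ n)%:Z).1) %% (p ^ n)%:Z)%Z|%N
  else 0%N.

Lemma padic_of_rat_seqE (z : rat) (n : nat) : (0 < p)%N ->
  coprime p `|denq z| ->
  ((denq z * (padic_of_rat_seq z n)%:Z)%R = numq z %[mod (p ^ n)%:Z])%Z.
Proof.
move=> p_gt0 cop; rewrite /padic_of_rat_seq cop.
have pn : (0 < p ^ n)%N by rewrite expn_gt0 p_gt0.
rewrite gez0_abs ?modz_ge0 ?eqz_nat -?lt0n // modzMmr.
case: egcdzP => u w e _ /=.
have g1 : gcdz (denq z) (p ^ n)%:Z = 1.
  apply/eqP; rewrite -[_ == _]/(coprimez _ _) coprimezE /=.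
  by rewrite coprime_sym coprimeXl.
rewrite g1 in e.
have -> : denq z * (numq z * u) = numq z + (- (numq z * w)) * (p ^ n)%:Z.
  rewrite mulrCA (mulrC (denq z)).
  have -> : u * denq z = 1 - w * (p ^ n)%:Z by rewrite -e addrK.
  by rewrite mulrBr mulr1 mulNr mulrA.
by rewrite addrC modzMDl.
Qed.

Lemma padic_of_rat_seqP (z : rat) (n : nat) :
  padic_of_rat_seq z n = (padic_of_rat_seq z n.+1 %% p ^ n)%N.
Proof.
have [p0|p_gt0] := posnP p.
  rewrite /padic_of_rat_seq; case: ifP => _; last by rewrite mod0n.
  case: n => [|n]; first by rewrite expn0 modn1 modz1.
  by rewrite p0 !exp0n // modn0.
case cop: (coprime p `|denq z|); last by rewrite /padic_of_rat_seq cop mod0n.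
have small : (padic_of_rat_seq z n < p ^ n)%N.
  rewrite /padic_of_rat_seq cop -ltz_nat gez0_abs ?modz_ge0 ?ltz_pmod //.
    by rewrite ltz_nat expn_gt0 p_gt0.
  by rewrite eqz_nat -lt0n expn_gt0 p_gt0.
have en := padic_of_rat_seqE n p_gt0 cop.
have en1 := padic_of_rat_seqE n.+1 p_gt0 cop.
rewrite -[LHS](modn_small small); apply/eqP.
rewrite -eqz_nat -!modz_nat eqz_mod_dvd.
rewrite -(@Gauss_dvdzr _ (denq z)); last first.
  by rewrite coprimezE /= coprimeXl.
rewrite mulrBr -eqz_mod_dvd en eq_sym.
have /eqP := en1; rewrite !eqz_mod_dvd; apply: dvdz_trans.
by rewrite dvdzE /= dvdn_exp2l.
Qed.

Definition padic_of_rat (z : rat) : padic_int p :=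
  PadicInt (padic_of_rat_seqP z).

(* The i-th digit of x in base q = p ^ e, read off x mod q ^ i.+1. *)
Definition qdigit (e : nat) (x : padic_int p) (i : nat) : nat :=
  (x (e * i.+1) %/ (p ^ e) ^ i)%N.

End PadicIntegers.

(* Gamma_{ari,v}(x), the product being indexed by the digits of x - 1. *)
Definition gamma_ari (R : realType) (F : finFieldType) (v : {poly F})
    (T : vadic_tower v R) (p e : nat) (x : padic_int p) : kv T :=
  xget 0 [set l : kv T | abs_lim (@kv_abs _ _ _ T)
    (fun n => \prod_(i < n)
       (- kv_in T (tofrac (Dv v i))) ^+ qdigit e (padic_pred x) i) l]%classic.

Section TranscendenceDegree.
Variable L : fieldType.

(* The subfield of L generated by K and S. *)
Definition adjoin (K S : {pred L}) : {pred L} :=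
  fun x => `[< forall E : {pred L}, GRing.divring_closed E ->
    {subset K <= E} -> {subset S <= E} -> x \in E >].

Definition algebraic_over (K : {pred L}) (x : L) : Prop :=
  exists P : {poly L}, [/\ P \is a polyOver K, P != 0 & root P x].

Definition alg_independent (K : {pred L}) (d : nat) (t : d.-tuple L) : Prop :=
  forall P : mpoly d L, P \is a mpolyOver d K ->
    meval (tnth t) P = 0 -> P = 0.

(* Here K and E are (the carriers of) subfields of L. *)
Definition transcendence_basis (K E : {pred L}) (d : nat) (t : d.-tuple L) :=
  [/\ {subset t <= E}, alg_independent K t
    & forall x, x \in E -> algebraic_over (adjoin K [in t]) x].

Definition has_trdeg (K E : {pred L}) (d : nat) : Prop :=
  exists t : d.-tuple L, transcendence_basis K E t.

End TranscendenceDegree.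

(* The values Gamma_{ari,v}(z), z in Q with (q^l - 1) z in Z; such z are
   p-integral. *)
Definition gamma_values (R : realType) (F : finFieldType) (v : {poly F})
    (T : vadic_tower v R) (p e l : nat) : {pred Cv T} :=
  fun y => `[< exists2 z : rat, ((#|F| ^ l)%:R - 1) * z \is a Num.int
                 & y = kv_to_Cv (gamma_ari T e (padic_of_rat p z)) >].

Arguments gamma_values {R F v} T p e l _.

(* Main.v *)
Require Import Defs.
From HB Require Import structures.
From mathcomp Require Import all_boot all_order all_algebra all_field.
From mathcomp Require Import boolp classical_sets reals.
From mathcomp Require Import -(notations) mpoly.
From mathcomp Require Import ring lra zify.
Set Implicit Arguments.
Unset Strict Implicit.
Unset Printing Implicit Defensive.
Import Order.TTheory GRing.Theory Num.Theory.
Local Open Scope ring_scope.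

(* Since [- D_{i,v}] tends to 1, the products of the [- D_{i,v}] over the indices
   [i] congruent to [c] modulo [m] converge, to [G_m(c)] say.  If
   [(q^l - 1) z] is an integer, the base [q] digits of [z - 1] are eventually
   periodic of period [l], so Gamma(z) is an element of [k] times a monomial in
   [G_l(0), ..., G_l(l-1)]; conversely each [G_l(c)] is the value of Gamma at
   [1 - q^c / (q^l - 1)].  Writing [D_i] for the product of all monic polynomials
   of degree [i], we have [D_{i,v} = D_i / (v^(q^(i-d)) D_{i-d})] with
   [d = deg v], so for [m = d] the partial products telescope; together with
   [D_{i+1} = (theta^(q^(i+1)) - theta) D_i^q] this yields in the limit an
   algebraic equation for [G_d(c)], Thakur's analogue of the Gross-Koblitz
   formula.  With [g = gcd(l, d)], the product of the [G_l(r)] over [r] congruent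
   to [c] modulo [g] is [G_g(c)], which is also a product of the algebraic
   [G_d(r)]; so [G_l(0), ..., G_l(g-1)] are algebraic over the [l - g] others. *)

(** * Algebraic elements and transcendence bases *)

(** Packaging a subfield as a field makes its inclusion a morphism, so that the closure properties
    of [algebraicOver] transfer to [algebraic_over]. *)
Record subfield_of {L : fieldType} (S : divringClosed L) := SubfieldOf {
  subfield_val :> L;
  _ : subfield_val \in S
}.

HB.instance Definition _ L S := [isSub for @subfield_val L S].
HB.instance Definition _ (L : fieldType) (S : divringClosed L) :=
  [Choice of subfield_of S by <:].
HB.instance Definition _ (L : fieldType) (S : divringClosed L) :=
  [SubChoice_isSubIntegralDomain of subfield_of S by <:].
HB.instance Definition _ (L : fieldType) (S : divringClosed L) :=
  [SubIntegralDomain_isSubField of subfield_of S by <:].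

Section AlgebraicOver.
Variables (L : fieldType) (S : divringClosed L).
Local Notation iota := (val : subfield_of S -> L).

Lemma algebraic_over_val (x : L) :
  algebraic_over S x <-> algebraicOver iota x.
Proof.
split=> [[P [/polyOverP PS P0 rP]]|[P P0 rP]]; last first.
  exists (map_poly iota P); split=> //; last by rewrite map_poly_eq0.
  by apply/polyOverP=> i; rewrite coef_map; apply: valP.
(* The default 0 is never taken on the coefficients of [P], which lie in [S]. *)
pose f (y : L) : subfield_of S := insubd 0 y.
have f0 : f 0 = 0.
  by apply: val_inj; apply: (insubdK (0 : subfield_of S)); apply: rpred0.
have fE : map_poly iota (map_poly f P) = P.
  apply/polyP=> i; rewrite coef_map coef_map_id0 ?f0 //.
  exact: (insubdK (0 : subfield_of S) (PS i)).
exists (map_poly f P); last by rewrite fE.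
by apply: contra_neq P0 => e; rewrite -fE e rmorph0.
Qed.

Definition algebraic_elements : {pred L} := fun x => `[< algebraic_over S x >].

Lemma algebraic_elements_divring_closed : GRing.divring_closed algebraic_elements.
Proof.
split=> [|x y|x y]; rewrite ?unfold_in.
- by apply/asboolP/algebraic_over_val/algebraic1.
- move=> /asboolP/algebraic_over_val ax /asboolP/algebraic_over_val ay.
  by apply/asboolP/algebraic_over_val/algebraic_sub.
- move=> /asboolP/algebraic_over_val ax /asboolP/algebraic_over_val ay.
  by apply/asboolP/algebraic_over_val/algebraic_div.
Qed.

HB.instance Definition _ := GRing.isDivringClosed.Build L algebraic_elements
  algebraic_elements_divring_closed.

Lemma algebraic_over_mem x : x \in S -> algebraic_over S x.
Proof.
move=> xS; apply/algebraic_over_val.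
by rewrite -[x]/(iota (SubfieldOf xS)); apply: algebraic_id.
Qed.

(** Over a field, algebraic means integral, and a root of a nonzero polynomial with integral
    coefficients is integral. *)
Lemma algebraic_over_trans (E : {pred L}) x :
  (forall y, y \in E -> algebraic_over S y) -> algebraic_over E x ->
  algebraic_over S x.
Proof.
move=> SE [P [/allP PE P0 rP]]; apply/algebraic_over_val.
apply/integral_algebraic; apply: integral_root P0 rP _ => y /PE yE.
by apply/integral_algebraic/algebraic_over_val/SE.
Qed.

End AlgebraicOver.

Section Adjoin.
Variables (L : fieldType).
Implicit Types (K S : {pred L}).

Lemma adjoin_divring_closed K S : GRing.divring_closed (adjoin K S).
Proof.
split=> [|x y|x y]; rewrite ?unfold_in.
- by apply/asboolP => E [].
- move=> /asboolP ax /asboolP ay; apply/asboolP => E EP KE SE.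
  by case: (EP) => _ + _; apply; [apply: ax | apply: ay].
- move=> /asboolP ax /asboolP ay; apply/asboolP => E EP KE SE.
  by case: (EP) => _ _; apply; [apply: ax | apply: ay].
Qed.

HB.instance Definition _ K S :=
  GRing.isDivringClosed.Build L (adjoin K S) (adjoin_divring_closed K S).

Lemma sub_adjoinl K S : {subset K <= adjoin K S}.
Proof. by move=> x xK; apply/asboolP => E _ KE _; apply: KE. Qed.

Lemma sub_adjoinr K S : {subset S <= adjoin K S}.
Proof. by move=> x xS; apply/asboolP => E _ _; apply. Qed.

Lemma adjoin_min K S (E : {pred L}) :
  GRing.divring_closed E -> {subset K <= E} -> {subset S <= E} ->
  {subset adjoin K S <= E}.
Proof. by move=> EP KE SE x /asboolP; apply. Qed.

Lemma algebraic_over_sub (E E' : {pred L}) x :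
  {subset E <= E'} -> algebraic_over E x -> algebraic_over E' x.
Proof.
move=> sEE [P [PE P0 rP]]; exists P; split=> //.
exact: polyOverS PE.
Qed.

(* Expanding a relation between [t] and [s] along powers of [s], each
   coefficient is a polynomial in [t], and one of these is nonzero. *)
Lemma alg_dependent_rcons (K : divringClosed L) d (t : d.-tuple L) (s : L) :
  alg_independent K t -> ~ alg_independent K [tuple of rcons t s] ->
  algebraic_over (adjoin K [in t]) s.
Proof.
move=> tK /existsNP[P] /not_implyP[/mpolyOverP PK] /not_implyP[Pts P0].
pose w (m : multinom d.+1) : multinom d := 
  Multinom [tuple (m (widen_ord (leqnSn d) i) : nat) | i < d].
pose Pk k : mpoly d L :=
  \sum_(m <- msupp P | m ord_max == k) mcoeff m P *: mpolyX L (w m).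
pose Q := \sum_(m <- msupp P)
  (mcoeff m P * \prod_(i < d) tnth t i ^+ w m i) *: 'X^(m ord_max).
have QE k : Q`_k = meval (tnth t) (Pk k).
  rewrite coef_sum raddf_sum /= big_mkcond [RHS]big_mkcond /=.
  apply: eq_bigr => m _; rewrite coefZ coefXn eq_sym mevalZ mevalX.
  by case: eqP; rewrite ?mulr1 ?mulr0.
have PkK k : Pk k \is a mpolyOver d K.
  by apply: rpred_sum => m _; apply: mpolyOverZ; rewrite ?PK ?mpolyOverX.
have w_inj m m' : w m = w m' -> m ord_max = m' ord_max -> m = m'.
  move=> /mnmP ww mm; apply/mnmP => i; case: (unliftP ord_max i) => [j|] -> //.
  have -> : lift ord_max j = widen_ord (leqnSn d) j.
    by exact/val_inj/lift_max.
  by have := ww j; rewrite !mnmE.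
exists Q; split.
- apply: rpred_sum => m _; rewrite polyOverZ ?rpredX ?polyOverX //.
  rewrite rpredM ?rpred_prod// => [|i _]; first exact/sub_adjoinl/PK.
  by rewrite rpredX //; apply/sub_adjoinr/mem_tnth.
(* If [Q] vanished, independence of [t] would kill every [Pk k]; as [m] is determined by [w m] and
   [m ord_max], every coefficient of [P] would vanish. *)
- apply/eqP => Q0; apply: P0; apply/mpolyP => m; rewrite mcoeff0.
  have [|] := boolP (m \in msupp P); last by move/memN_msupp_eq0.
  move=> mP; have : mcoeff (w m) (Pk (m ord_max)) = 0.
    by rewrite (tK _ (PkK _)) ?mcoeff0 // -QE Q0 coef0.
  rewrite raddf_sum /= big_mkcond (bigD1_seq m) ?msupp_uniq //= eqxx big1.
    by rewrite addr0 mcoeffZ mcoeffX eqxx mulr1.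
  move=> m' /eqP m'm; case: eqP => // mm; rewrite mcoeffZ mcoeffX.
  by case: eqP => [/w_inj/(_ mm)//|]; rewrite mulr0.
- rewrite rootE -[0]Pts horner_sum mevalE; apply/eqP/eq_bigr => m _.
  rewrite hornerZ hornerXn -mulrA big_ord_recr /=; congr (_ * (_ * _)).
    apply: eq_bigr => i _; rewrite mnmE; congr (_ ^+ _).
    by rewrite !(tnth_nth 0) /= nth_rcons size_tuple ltn_ord.
  by rewrite (tnth_nth 0) /= nth_rcons size_tuple ltnn eqxx.
Qed.

Lemma alg_independent_nil (K : {pred L}) (t : 0.-tuple L) :
  alg_independent K t.
Proof.
move=> P _; have -> : P = mpolyC 0 (mcoeff mnm0 P).
  apply/mpolyP => m; have -> : m = mnm0 by apply/mnmP => -[].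
  by rewrite mcoeffC eqxx mulr1.
by rewrite mevalC => ->; rewrite mpolyC0.
Qed.

(** Greedy choice: an element is kept if it is independent of those already kept; otherwise it is
    algebraic over them by [alg_dependent_rcons]. *)
Lemma alg_basis (K : divringClosed L) (s : seq L) :
  exists2 d, (d <= size s)%N & exists t : d.-tuple L,
    [/\ {subset t <= s}, alg_independent K t
      & forall x, x \in s -> algebraic_over (adjoin K [in t]) x].
Proof.
elim: s => [|x s [d ds [t [ts tK ts_alg]]]].
  exists 0 => //; exists [tuple]; split=> //; exact: alg_independent_nil.
have [xtK|/alg_dependent_rcons xt_alg] :=
    pselect (alg_independent K [tuple of rcons t x]).
  exists d.+1 => //; exists [tuple of rcons t x]; split=> //.
    by move=> y; rewrite mem_rcons !inE => /predU1P[->|/ts ->];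
      rewrite ?eqxx ?orbT.
  move=> y; rewrite inE => /predU1P[->|ys].
    by apply/algebraic_over_mem/sub_adjoinr;
      rewrite -[_ \in _]/(x \in rcons t x) mem_rcons mem_head.
  apply: algebraic_over_sub (ts_alg _ ys).
  apply: adjoin_min; [exact: adjoin_divring_closed|exact: sub_adjoinl|].
  move=> z zt; apply: sub_adjoinr; rewrite -[_ \in _]/(z \in rcons t x).
  by rewrite mem_rcons in_cons (zt : z \in t) orbT.
exists d; first exact: leqW.
exists t; split=> // [y /ts|y]; rewrite inE; first by move=> ->; rewrite orbT.
by case/predU1P => [->|]; [apply: xt_alg|apply: ts_alg].
Qed.

(** A basis chosen among [s] serves for all of [adjoin K S]: algebraicity is transitive, and since
    algebraic elements form a field it suffices to check generators. *)
Lemma has_trdeg_le (K : divringClosed L) (S : {pred L}) (s : seq L) :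
  {subset s <= adjoin K S} ->
  (forall x, x \in S -> algebraic_over (adjoin K [in s]) x) ->
  exists2 d, has_trdeg K (adjoin K S) d & (d <= size s)%N.
Proof.
move=> sS S_alg; have [d ds [t [ts tK ts_alg]]] := alg_basis K s.
exists d => //; exists t; split=> // [x /ts/sS//|].
pose F := adjoin K [in t].
suff sF : {subset adjoin K S <= algebraic_elements F} by move=> x /sF /asboolP.
have FP := algebraic_elements_divring_closed F.
apply: adjoin_min => // x xK; apply/asboolP.
  exact/algebraic_over_mem/sub_adjoinl.
apply: algebraic_over_trans (S_alg _ xK) => y yP.
suff sF : {subset adjoin K [in s] <= algebraic_elements F} by apply/asboolP/sF.
apply: adjoin_min => // z zP; apply/asboolP; last exact: ts_alg.
exact/algebraic_over_mem/sub_adjoinl.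
Qed.

End Adjoin.

(** * Products of monic polynomials *)

Lemma exprBn_pchar_exp (R : comNzRingType) (p n : nat) (a b : R) :
  p \in [pchar R] -> (a - b) ^+ (p ^ n) = a ^+ (p ^ n) - b ^+ (p ^ n).
Proof.
move=> pR; have pn : [pchar R].-nat (p ^ n)%N.
  by rewrite pnatX (eq_pnat _ (pcharf_eq pR)) pnat_id ?orbT // (pcharf_prime pR).
by rewrite exprDn_pchar // exprNn_pchar.
Qed.

(** The factorization of [X^q - X] over [F], evaluated at [y / d] and multiplied by [d ^+ q]; the
    case [d = 0] is apart. *)
Lemma prod_sub_image_card (F : finFieldType) (K : fieldType)
    (f : {rmorphism F -> K}) (y d : K) :
  \prod_(c : F) (y - f c * d) = y ^+ #|F| - d ^+ #|F|.-1 * y.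
Proof.
have q1 : (1 < #|F|)%N := finNzRing_gt1 F.
have qE : #|F| = #|F|.-1.+1 by rewrite prednK // ltnW.
have [->|d0] := eqVneq d 0.
  under eq_bigr do rewrite mulr0 subr0.
  by rewrite prodr_const expr0n -subn1 subn_eq0 leqNgt q1 mul0r subr0.
have := congr1 (fun P => d ^+ #|F| * (map_poly f P).[y / d]) (finField_genPoly F).
rewrite rmorphB rmorphXn /= map_polyX rmorph_prod !hornerE horner_prod.
under eq_bigr do rewrite rmorphB /= map_polyX map_polyC !hornerE.
move=> e.
rewrite (eq_bigr (fun c => d * (y / d - f c))); last first.
  by move=> c _; rewrite mulrBr [d * (y / d)]mulrC divfK // [d * f c]mulrC.
rewrite big_split prodr_const /= -e mulrBr [_ * _ ^+ _]mulrC.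
rewrite expr_div_n divfK ?expf_neq0 //.
by rewrite [in X in _ - X]qE exprSr -mulrA [d * (y / d)]mulrC divfK.
Qed.

Lemma prod_subZ_card (F : finFieldType) (a d : {poly F}) :
  \prod_(c : F) (a - c *: d) = a ^+ #|F| - d ^+ #|F|.-1 * a.
Proof.
pose f : {rmorphism F -> {fraction {poly F}}} := @tofrac {poly F} \o polyC.
apply/eqP; rewrite -tofrac_eq; apply/eqP.
rewrite tofracB tofracM !tofracXn -(prod_sub_image_card f) rmorph_prod.
by apply: eq_bigr => c _; rewrite -mul_polyC rmorphB rmorphM.
Qed.

(** * Carlitz's polynomials and the product of the monic polynomials of given degree *)

Section Carlitz.
Variables (F : finFieldType) (p e : nat).
Hypotheses (p_prime : prime p) (cardF : #|F| = (p ^ e)%N).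
Local Notation q := #|F|.
Local Notation A := {poly F}.

Lemma pchar_poly_card : p \in [pchar A].
Proof. by rewrite pchar_poly; apply: card_finPcharP cardF p_prime. Qed.

Lemma exprB_card n (a b : A) : (a - b) ^+ (q ^ n) = a ^+ (q ^ n) - b ^+ (q ^ n).
Proof. by rewrite cardF -expnM exprBn_pchar_exp ?pchar_poly_card. Qed.

Lemma exprZ_card (c : F) (a : A) : (c *: a) ^+ q = c *: a ^+ q.
Proof. by rewrite exprZn expf_card. Qed.

(* Carlitz's [e_n(x)], the product of all [x - b] with [deg b < n]
   ([carlitz_prod]). *)
Fixpoint carlitz n (x : A) : A :=
  if n is m.+1 then
    carlitz m x ^+ q - carlitz m 'X^m ^+ q.-1 * carlitz m x
  else x.

(** Carlitz's [D_n], by [carlitzD_prod] the product of the monic polynomials of degree [n]. *)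
Definition carlitzD n := carlitz n 'X^n.

Definition bracket n : A := 'X^(q ^ n) - 'X.

Lemma carlitzS n x :
  carlitz n.+1 x = carlitz n x ^+ q - carlitzD n ^+ q.-1 * carlitz n x.
Proof. by []. Qed.

Arguments carlitz : simpl never.

Lemma carlitzB n x y : carlitz n (x - y) = carlitz n x - carlitz n y.
Proof.
elim: n => // n IHn; rewrite !carlitzS IHn.
have := exprB_card 1 (carlitz n x) (carlitz n y).
by rewrite expn1 => ->; ring.
Qed.

Lemma carlitzZ n c x : carlitz n (c *: x) = c *: carlitz n x.
Proof.
elim: n => // n IHn; rewrite !carlitzS IHn exprZ_card -!mul_polyC; ring.
Qed.

Lemma carlitzS_Xn n : carlitz n.+1 'X^n = 0.
Proof.
rewrite carlitzS -exprSr prednK ?subrr //; exact: ltnW (finNzRing_gt1 F).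
Qed.

(* Carlitz's relation; at [x = 'X^n] the first summand vanishes, which gives
   the recursion for [carlitzD]. *)
Lemma carlitz_mulX n x :
  carlitz n.+1 ('X * x) =
  'X * carlitz n.+1 x + bracket n.+1 * carlitz n x ^+ q.
Proof.
have q1 : (q = q.-1.+1)%N by rewrite prednK //; exact: ltnW (finNzRing_gt1 F).
elim: n x => [|n IHn] x.
  rewrite /bracket !carlitzS /carlitzD /carlitz expn1 expr0 expr1n !mul1r.
  by rewrite exprMn; ring.
have D : carlitzD n.+1 = bracket n.+1 * carlitzD n ^+ q.
  by rewrite /carlitzD exprS IHn carlitzS_Xn mulr0 add0r.
have exprB1 (a b : A) : (a - b) ^+ q = a ^+ q - b ^+ q.
  by have := exprB_card 1 a b; rewrite expn1.
(* With [u = carlitz n.+1 x], the terms involving ['X] cancel; what remains is [bracket n.+1 ^+ q]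
   times the [q]-th power of the recursion defining [u]. *)
have u_q : carlitz n.+1 x ^+ q = carlitz n x ^+ q ^+ q
    - (carlitzD n ^+ q) ^+ q.-1 * carlitz n x ^+ q.
  by rewrite carlitzS exprB1 exprMn -!exprM mulnC.
have b_q : bracket n.+2 = bracket n.+1 ^+ q + 'X^q - 'X.
  by rewrite /bracket exprB1 -exprM -expnSr subrK.
rewrite !(carlitzS n.+1) IHn D b_q exprMn.
have exprN1 (b : A) : (- b) ^+ q = - b ^+ q.
  by have := exprB1 0 b; rewrite expr0n [in _%:R]q1 !sub0r.
have -> (a b : A) : (a + b) ^+ q = a ^+ q + b ^+ q.
  by have := exprB1 a (- b); rewrite exprN1 !opprK.
rewrite !exprMn u_q.
have -> : bracket n.+1 ^+ q = bracket n.+1 * bracket n.+1 ^+ q.-1.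
  by rewrite [in LHS]q1 exprS.
ring.
Qed.

Lemma carlitzD_rec n : carlitzD n.+1 = bracket n.+1 * carlitzD n ^+ q.
Proof. by rewrite /carlitzD exprS carlitz_mulX carlitzS_Xn mulr0 add0r. Qed.

Lemma carlitzD_recn n s :
  carlitzD (n + s) = carlitzD n ^+ (q ^ s)
    * \prod_(i < s) bracket (n + s - i) ^+ (q ^ i).
Proof.
elim: s => [|s IHs]; first by rewrite addn0 big_ord0 mulr1 expr1.
rewrite addnS carlitzD_rec IHs big_ord_recl subn0 expr1 exprMn -exprM -expnSr.
rewrite mulrCA; congr (_ * (_ * _)); rewrite -prodrXl.
by apply: eq_bigr => i _; rewrite subSS -exprM -expnSr.
Qed.

(** A polynomial of size at most [n + 1] is [c X^n + b]. The product over [b] is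
    [carlitz n x - c *: carlitzD n] by linearity, and [prod_subZ_card] evaluates the product over
    [c]. *)
Lemma carlitz_prod n x :
  carlitz n x = \prod_(b : {poly_n F}) (x - (b : {poly F})).
Proof.
elim: n x => [|n IHn] x.
  rewrite (bigD1 0) //= big1 ?mulr1 ?subr0 // => b /eqP[].
  by apply/npolyP => i; rewrite !big_coef_npoly.
pose h (cb : F * {poly_n F}) := npolyp n.+1 (cb.1 *: 'X^n + (cb.2 : A)).
pose h' (a : {poly_n.+1 F}) := ((a : A)`_n, npolyp n a).
have hE c b : h (c, b) = c *: 'X^n + (b : A) :> A.
  rewrite npolypK // (leq_trans (size_polyD _ _)) // geq_max.
  by rewrite (leq_trans (size_scale_leq _ _)) ?size_polyXn // leqW ?size_npoly.
have hK : cancel h h'.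
  move=> [c b]; rewrite /h' hE; congr (_, _).
    by rewrite coefD coefZ coefXn eqxx mulr1 big_coef_npoly ?addr0.
  apply/npolyP => i; rewrite coef_npolyp coefD coefZ coefXn.
  case: ltngtP => [_|ni|->] /=; first by rewrite mulr0 add0r.
    by rewrite big_coef_npoly // ltnW.
  by rewrite big_coef_npoly.
have h'K : cancel h' h.
  move=> a; apply/npolyP => i; rewrite hE coefD coefZ coefXn coef_npolyp.
  case: ltngtP => [_|ni|->] /=; rewrite ?mulr0 ?mulr1 ?add0r ?addr0 //.
  by rewrite big_coef_npoly.
rewrite (reindex h) /=; last by exists h' => ? _; [exact: hK|exact: h'K].
rewrite -(pair_bigA _ (fun c b => x - h (c, b))) /= carlitzS.
rewrite -prod_subZ_card; apply: eq_bigr => c _.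
rewrite -carlitzZ -carlitzB IHn; apply: eq_bigr => b _.
by rewrite hE opprD addrA.
Qed.

(** The monic polynomials of degree [n] are the ['X^n - b] with [b] of smaller degree, the factors
    of [carlitz_prod] at ['X^n]. *)
Lemma carlitzD_prod n :
  carlitzD n = \prod_(a : {poly_n.+1 F} | ((a : A) \is monic) && (pdeg a == n))
    (a : A).
Proof.
pose h (b : {poly_n F}) := npolyp n.+1 ('X^n - (b : A)).
pose h' (a : {poly_n.+1 F}) := npolyp n ('X^n - (a : A)).
have hE (b : {poly_n F}) : h b = 'X^n - (b : A) :> A.
  rewrite npolypK // (leq_trans (size_polyD _ _)) // geq_max.
  by rewrite size_polyXn size_polyN leqnn /= leqW ?size_npoly.
have h_monic (b : {poly_n F}) : ((h b : A) \is monic) && (pdeg (h b) == n).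
  have szb : (size (- (b : A)) < size ('X^n : A))%N.
    by rewrite size_polyXn size_polyN ltnS size_npoly.
  by rewrite hE /pdeg monicE lead_coefDl // size_polyDl // size_polyXn
    lead_coefXn !eqxx.
rewrite /carlitzD carlitz_prod (reindex_onto h h') /=.
  apply: eq_big => [b|b _]; last by rewrite hE.
  apply/esym/andP; split; first exact: h_monic.
  apply/eqP/npolyP => i; rewrite coef_npolyp hE opprB addrC subrK.
  by case: ltnP => // /big_coef_npoly ->.
move=> a /andP[a_monic /eqP an]; apply/npolyP => i.
rewrite hE coefB coef_npolyp coefB; case: ltngtP => [_|ni|->].
- by rewrite opprB addrC subrK.
- by rewrite subr0 coefXn gtn_eqF // big_coef_npoly.
- rewrite subr0 coefXn eqxx; have := monicP a_monic.
  by rewrite /lead_coef -/(pdeg _) an => ->.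
Qed.

Lemma carlitzD_neq0 n : carlitzD n != 0.
Proof.
rewrite carlitzD_prod prodf_seq_neq0; apply/allP => a _; apply/implyP.
by case/andP => /monic_neq0.
Qed.

(** * Removing the multiples of [v]; congruences modulo [v] *)

Section Place.
Variable v : A.
Hypotheses (v_monic : v \is monic) (v_irr : irreducible_poly v).
Local Notation d := (pdeg v).

Lemma size_place : size v = d.+1.
Proof. by rewrite /pdeg prednK // size_poly_gt0 monic_neq0. Qed.

Lemma pdeg_place_gt0 : (0 < d)%N.
Proof. by have [+ _] := v_irr; rewrite size_place ltnS. Qed.

Lemma Dv_small m : (m < d)%N -> Dv v m = carlitzD m.
Proof.
move=> md; rewrite carlitzD_prod /Dv; apply: eq_bigl => a.
apply/and3P/andP => [[]|[a1 a2]] //; split=> //.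
apply/negP => /dvdp_leq; rewrite monic_neq0 // => /(_ isT).
rewrite size_place leqNgt ltnS (leq_trans _ md) // -(eqP a2) /pdeg prednK //.
Qed.

(** The monic multiples of [v] of degree [k + d] are [v] times the [q ^ k] monic polynomials of
    degree [k]. *)
Lemma carlitzD_Dv k :
  carlitzD (k + d) = Dv v (k + d) * (v ^+ (q ^ k) * carlitzD k).
Proof.
rewrite carlitzD_prod (bigID (fun a : {poly_(k + d).+1 F} => v %| (a : A))) /=.
rewrite mulrC; congr (_ * _).
  by apply: eq_bigl => a; rewrite andbA.
have v0 : v != 0 := monic_neq0 v_monic.
pose h (b : {poly_k F}) := npolyp (k + d).+1 (v * ('X^k - (b : A))).
pose h' (a : {poly_(k + d).+1 F}) := npolyp k ('X^k - (a : A) %/ v).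
have szb (b : {poly_k F}) : (size (- (b : A)) < size ('X^k : A))%N.
  by rewrite size_polyXn size_polyN ltnS size_npoly.
have szXb (b : {poly_k F}) : size ('X^k - (b : A)) = k.+1.
  by rewrite size_polyDl // size_polyXn.
have monicXb (b : {poly_k F}) : 'X^k - (b : A) \is monic.
  by rewrite monicE lead_coefDl // lead_coefXn.
have hE (b : {poly_k F}) : h b = v * ('X^k - (b : A)) :> A.
  by rewrite npolypK // size_monicM ?monic_neq0 // szXb size_place addnC addnS addSn.
rewrite (reindex_onto h h') /= => [|a /andP[/andP[a_monic /eqP ad] va]].
  rewrite /carlitzD carlitz_prod -(card_npoly F k) -prodr_const -big_split /=.
  apply: eq_big => [b|b _]; last by rewrite hE.
  rewrite hE dvdp_mulIl monicMl // monicXb /pdeg size_monicM ?monic_neq0 // szXb.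
  rewrite size_place addSn addnS addnC eqxx /=; apply/eqP/npolyP => i.
  rewrite coef_npolyp hE mulKp // opprB addrC subrK.
  by case: ltnP => // /big_coef_npoly ->.
have [c ac] := dvdpP _ _ va.
have c_monic : c \is monic by move: a_monic; rewrite ac monicMr.
have sc : size c = k.+1.
  move: ad; rewrite ac /pdeg size_Mmonic ?monic_neq0 // size_place.
  rewrite addnS /= => /(congr1 succn); rewrite -addSn.
  rewrite prednK ?addn_gt0 ?size_poly_gt0 ?monic_neq0 // => e0.
  by apply/eqP; rewrite -(eqn_add2r d) e0.
apply: val_inj => /=; rewrite -/(h _) hE /h' ac mulpK // mulrC; congr (_ * _).
apply/polyP => i; rewrite coefB coef_npolyp coefB; case: ltngtP => [_|ki|->].
- by rewrite opprB addrC subrK.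
- by rewrite subr0 coefXn gtn_eqF // nth_default // sc.
- rewrite subr0 coefXn eqxx; have := monicP c_monic.
  by rewrite /lead_coef sc => ->.
Qed.

(** After substituting [carlitzD_Dv] in [carlitzD_rec] at [m], the power of [v] and
    [carlitzD (m - d) ^+ q] cancel; the bracket on the left comes from [carlitzD_rec] at [m - d]. *)
Lemma Dv_rec m : (d <= m)%N ->
  Dv v m.+1 * bracket (m.+1 - d) = bracket m.+1 * Dv v m ^+ q.
Proof.
move=> dm; have e1 := carlitzD_Dv (m - d); have e2 := carlitzD_Dv (m.+1 - d).
have := carlitzD_rec m; move: e1 e2; rewrite !subnK ?leqW // => -> ->.
rewrite subSn // carlitzD_rec !exprMn -exprM -expnSr => eD.
have nz : v ^+ (q ^ (m - d).+1) * carlitzD (m - d) ^+ q != 0.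
  by rewrite mulf_neq0 ?expf_neq0 ?carlitzD_neq0 ?monic_neq0.
apply: (mulIf nz); by rewrite -!mulrA [bracket (m - d).+1 * _]mulrCA -eD !mulrA.
Qed.

(** Iterating [carlitzD_Dv] descends in steps of [d] to the index [j < d], where [Dv] and [carlitzD]
    agree. *)
Lemma prod_Dv_carlitzD j n : (j < d)%N ->
  (\prod_(r < n.+1) Dv v (j + r * d)) * v ^+ (\sum_(r < n) q ^ (j + r * d))
  = carlitzD (j + n * d).
Proof.
move=> jd; elim: n => [|n IHn].
  by rewrite big_ord1 big_ord0 mul0n addn0 mulr1 Dv_small.
have e1 : (j + n.+1 * d = j + n * d + d)%N by rewrite mulSn addnCA addnC.
rewrite e1 carlitzD_Dv -IHn.
rewrite big_ord_recr [in X in v ^+ X]big_ord_recr /= exprD.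
rewrite e1; ring.
Qed.

(* The powers of [v] telescope in [prod_Dv_carlitzD], leaving [v ^ (q ^ j)]. *)
Lemma prod_Dv_rec j n : (j < d)%N ->
  (\prod_(r < n.+2) Dv v (j + r * d)) * v ^+ (q ^ j) =
  (\prod_(r < n.+1) Dv v (j + r * d)) ^+ (q ^ d)
    * \prod_(s < d) bracket (j + n.+1 * d - s) ^+ (q ^ s).
Proof.
move=> jd; have := prod_Dv_carlitzD n.+1 jd.
have -> : (j + n.+1 * d = j + n * d + d)%N by rewrite mulSn addnCA addnC.
rewrite carlitzD_recn.
rewrite -(prod_Dv_carlitzD n jd) [X in _ * v ^+ X = _]big_ord_recl mul0n addn0.
rewrite exprD mulrA.
have -> : (\sum_(i < n) q ^ (j + bump 0 i * d)
    = (\sum_(r < n) q ^ (j + r * d)) * q ^ d)%N.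
  rewrite big_distrl /=; apply: eq_bigr => i _.
  by rewrite -expnD mulSn addnCA addnC.
rewrite exprM exprMn [X in _ = X]mulrAC => /mulIf; apply.
by rewrite !expf_neq0 ?monic_neq0.
Qed.

Lemma mi_place : monic_irreducible_poly v. Proof. by []. Qed.
Local Notation Q := {poly %/ v with mi_place}.

Lemma card_place : #|{poly %/ v with mi_place}| = (q ^ d)%N.
Proof. by rewrite card_qfpoly. Qed.

Lemma in_qpoly_eq0 (a : A) : (in_qpoly v a == 0) = (v %| a).
Proof.
have vI := mi_place; apply/eqP/idP => [/val_eqP /= | va].
  by rewrite -Pdiv.IdomainMonic.modpE // mk_monicE.
by apply/val_eqP; rewrite /= -Pdiv.IdomainMonic.modpE // mk_monicE.
Qed.

(** The residue field of [v] has [q ^ d] elements, so its elements are fixed by the power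
    [q ^ d]. *)
Lemma dvdp_bracket_place : v %| bracket d.
Proof.
rewrite -in_qpoly_eq0 /bracket rmorphB rmorphXn /= -card_place.
by rewrite (expf_card (in_qpoly v 'X : Q)) subrr.
Qed.

(* The derivative of [bracket n] is [-1]. *)
Lemma dvdp_bracket_sq n : (0 < n)%N -> ~~ (v ^+ 2 %| bracket n).
Proof.
move=> n0; apply/negP => /dvdpP[c /(congr1 (@deriv _))].
have q0 : (q ^ n)%:R = 0 :> A.
  rewrite cardF -expnM natrX (pcharf0 pchar_poly_card) expr0n.
  have : (0 < e * n)%N; last by case: (e * n)%N.
  rewrite muln_gt0 n0 andbT lt0n; apply/eqP => e0.
  by have := finNzRing_gt1 F; rewrite cardF e0.
rewrite derivB derivXn derivX -mulr_natr q0 mulr0 sub0r => eD.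
have: v %| - (1 : A).
  rewrite eD expr2 !derivM.
  have -> : c^`() * (v * v) + c * (v^`() * v + v * v^`())
      = (c^`() * v + c * v^`() + c * v^`()) * v by ring.
  exact: dvdp_mulIr.
rewrite dvdpNr dvdp1 size_place.
by case: d pdeg_place_gt0.
Qed.

(** Dividing the factorization of [X^|K| - X] by [X] and evaluating at 0 gives the product of the
    [- x]; the change of variable [x -> - x] absorbs the signs. *)
Lemma prod_finField_neq0 (K : finFieldType) : \prod_(x : K | x != 0) x = -1.
Proof.
have K1 : (1 < #|K|)%N := finNzRing_gt1 K.
have KE : #|K| = #|K|.-1.+1 by rewrite prednK // ltnW.
have := finField_genPoly K.
rewrite (bigD1 0) //= subr0 [in 'X^_]KE exprS -[X in _ - X]mulr1 -mulrBr.
move=> /(mulfI (negbT (polyX_eq0 _))) /(congr1 (horner^~ 0)).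
rewrite !hornerE horner_prod expr0n -subn1 subn_eq0 leqNgt K1 sub0r => ->.
rewrite [LHS](reindex_inj oppr_inj) /=.
by apply: eq_big => x; rewrite ?oppr_eq0 // hornerXsubC sub0r.
Qed.

(** The monic polynomials of degree [d] are [v + x] with [x] a reduced residue, so those prime to
    [v] represent each nonzero class once, and Wilson's theorem applies. *)
Lemma dvdp_Dv_wilson : v %| Dv v d + 1.
Proof.
have monicvx (x : Q) : v + (x : A) \is monic /\ size (v + (x : A)) = d.+1.
  have szx : (size (x : A) < size v)%N.
    by rewrite -[X in (_ < size (polyseq X))%N](mk_monicE mi_place) size_mk_monic.
  by rewrite monicE lead_coefDl // size_polyDl // size_place.
have vQ : in_qpoly v v = 0 by apply/eqP; rewrite in_qpoly_eq0.
pose h (x : Q) := npolyp d.+1 (v + (x : A)).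
have hE x : h x = v + (x : A) :> A by rewrite npolypK // (monicvx x).2.
rewrite -in_qpoly_eq0 rmorphD rmorph1 /Dv rmorph_prod /=.
rewrite (reindex_onto h (fun a => in_qpoly v a)) /= => [|a /and3P[a1 /eqP ad _]].
  rewrite addr_eq0; apply/eqP.
  apply: etrans (prod_finField_neq0 {poly %/ v with mi_place}).
  have in_h x : in_qpoly v (h x) = x.
    rewrite hE rmorphD /= vQ add0r; apply: val_inj.
    exact/in_qpoly_small/size_mk_monic.
  apply: eq_big => [x|x _]; last exact: in_h.
  have [x1 x2] := monicvx x.
  by rewrite in_h eqxx andbT -in_qpoly_eq0 in_h hE x1 /pdeg x2 eqxx.
have sa : size (a : A) = d.+1.
  have := congr1 succn ad; rewrite {1}/pdeg prednK //.
  by rewrite size_poly_gt0 monic_neq0.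
have sav : (size ((a : A) - v)%R < size (mk_monic v))%N.
  rewrite (mk_monicE mi_place) size_place ltnS; apply/leq_sizeP => j.
  rewrite leq_eqVlt coefB => /predU1P[<-|dj].
    have := monicP v_monic; have := monicP a1.
    by rewrite /lead_coef sa size_place /= => -> ->; rewrite subrr.
  by rewrite !nth_default ?subr0 ?sa ?size_place.
apply: val_inj; rewrite -[LHS]/(qpoly.polyn (h _)) hE.
have -> : in_qpoly v a = in_qpoly v ((a : A) - v) by rewrite rmorphB /= vQ subr0.
by rewrite in_qpoly_small // addrC subrK.
Qed.

End Place.
End Carlitz.

(** * Ultrametric limits and the v-adic absolute value *)

Section Absv.
Variables (R : realType) (F : finFieldType) (v : {poly F}).
Hypotheses (v_irr : irreducible_poly v).
Local Notation A := {poly F}.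
Local Notation absv := (absv v R).

Let v_size : (1 < size v)%N. Proof. by case: v_irr. Qed.
Let v_neq0 : v != 0. Proof. by rewrite -size_poly_gt0 ltnW. Qed.

Lemma dvdp_ordv (a : A) : a != 0 -> v ^+ ordv v a %| a.
Proof.
move=> a0; rewrite /ordv; have a_gt0 : (0 < size a)%N by rewrite size_poly_gt0.
pose P := fun n : 'I_(size a) => v ^+ n %| a.
have P0 : P (Ordinal a_gt0) by rewrite /P expr0 dvd1p.
by have [i Pi ->] := eq_bigmax_cond (fun n : 'I_(size a) => n : nat)
  (introT card_gt0P (ex_intro (fun n => n \in P) _ P0)).
Qed.

Lemma ordv_max (a : A) n : a != 0 -> v ^+ n %| a -> (n <= ordv v a)%N.
Proof.
move=> a0 va; have na : (n < size a)%N.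
  have sv : (0 < (size v).-1)%N by rewrite -subn1 subn_gt0.
  have := dvdp_leq a0 va; apply: leq_trans.
  have vn : (0 < size (v ^+ n)%R)%N by rewrite size_poly_gt0 expf_neq0.
  by rewrite -(prednK vn) size_exp ltnS leq_pmull.
exact: (@leq_bigmax_cond _ (fun i : 'I_(size a) => v ^+ i %| a)
  (fun i => i : nat) (Ordinal na)).
Qed.

(** [absv] is read off a chosen representative of the fraction, of which one knows only that its
    numerator is [a] times its denominator [d]. *)
Lemma absv_tofrac (a : A) : a != 0 -> exists2 d : A, d != 0 &
  absv (tofrac a) =
    (#|F|%:R ^+ pdeg v) ^+ ordv v d / (#|F|%:R ^+ pdeg v) ^+ ordv v (a * d).
Proof.
move=> a0; rewrite /absv tofrac_eq0 (negPf a0).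
exists \d_(generic_quotient.repr (tofrac a)); first exact: denom_ratioP.
congr (_ / _ ^+ ordv v _).
have := FracField.equivf_l (Ratio a 1).
rewrite !numden_Ratio ?oner_eq0 // mulr1 [_ * a]mulrC => e.
by unlock FracField.tofrac.
Qed.

Local Notation c := (#|F|%:R ^+ pdeg v : R).

Let c_gt1 : 1 < c.
Proof.
rewrite exprn_egt1 // ?ltr1n ?finNzRing_gt1 //.
by rewrite /pdeg -lt0n -subn1 subn_gt0.
Qed.

Let cX_gt0 n : 0 < c ^+ n. Proof. by rewrite exprn_gt0 // (lt_trans ltr01). Qed.

Lemma absv_le1 (a : A) : absv (tofrac a) <= 1.
Proof.
have [->|a0] := eqVneq a 0; first by rewrite /absv tofrac0 eqxx.
have [d d0 ->] := absv_tofrac a0.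
rewrite ler_pdivrMr // mul1r ler_eXn2l // ordv_max ?mulf_neq0 //.
by rewrite dvdp_mull ?dvdp_ordv.
Qed.

Lemma absv_lt1 (a : A) : v %| a -> absv (tofrac a) < 1.
Proof.
have [->|a0 va] := eqVneq a 0; first by rewrite /absv tofrac0 eqxx.
have [d d0 ->] := absv_tofrac a0.
rewrite ltr_pdivrMr // mul1r ltr_eXn2l // ordv_max ?mulf_neq0 //.
by rewrite exprS dvdp_mul ?dvdp_ordv.
Qed.

Lemma absv_eq1 (a : A) : ~~ (v %| a) -> absv (tofrac a) = 1.
Proof.
have [->|a0 va] := eqVneq a 0; first by rewrite dvdp0.
have [d d0 ->] := absv_tofrac a0.
suff -> : ordv v (a * d) = ordv v d by rewrite divff ?gt_eqF.
apply/eqP; rewrite eqn_leq !ordv_max ?mulf_neq0 // ?dvdp_mull ?dvdp_ordv //.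
rewrite -(@Gauss_dvdpr _ _ a) ?dvdp_ordv ?mulf_neq0 //.
by rewrite coprimep_expl // irreducible_poly_coprime.
Qed.

End Absv.

(** * Limits for a non-archimedean absolute value *)

Section AbsoluteValue.
Variables (R : realType) (K : fieldType) (abs : K -> R).
Hypothesis absP : is_na_absval abs.

Lemma na_ge0 x : 0 <= abs x. Proof. by case: absP. Qed.
Lemma na_eq0 x : (abs x == 0) = (x == 0). Proof. by case: absP. Qed.
Lemma naM x y : abs (x * y) = abs x * abs y. Proof. by case: absP. Qed.
Lemma naD x y : abs (x + y) <= Num.max (abs x) (abs y). Proof. by case: absP. Qed.
Lemma na0 : abs 0 = 0. Proof. by apply/eqP; rewrite na_eq0. Qed.

Lemma na1 : abs 1 = 1.
Proof.
have n0 : abs 1 != 0 by rewrite na_eq0 oner_eq0.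
by apply: (mulfI n0); rewrite -naM !mulr1.
Qed.

Lemma naX x n : abs (x ^+ n) = abs x ^+ n.
Proof. by elim: n => [|n IH]; rewrite ?expr0 ?na1 // !exprS naM IH. Qed.

Lemma naN x : abs (- x) = abs x.
Proof.
apply/eqP; rewrite -(@eqrXn2 _ 2) ?na_ge0 // -!naX sqrrN //.
Qed.

Lemma naB x y : abs (x - y) <= Num.max (abs x) (abs y).
Proof. by rewrite -(naN y) naD. Qed.

Lemma naBC x y : abs (x - y) = abs (y - x).
Proof. by rewrite -naN opprB. Qed.

Lemma na_sub_trans y x z : abs (x - z) <= Num.max (abs (x - y)) (abs (y - z)).
Proof. by rewrite -[x in x - z](subrK y) -addrA naD. Qed.

Lemma na_prod_eq1 I (r : seq I) (P : pred I) (f : I -> K) :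
  (forall i, P i -> abs (f i) = 1) -> abs (\prod_(i <- r | P i) f i) = 1.
Proof.
by move=> f1; elim/big_ind: _ => [|x y x1 y1|//]; rewrite ?na1 // naM x1 y1 mulr1.
Qed.

Local Notation lim := (abs_lim abs).

Lemma abs_lim_unique u l m : lim u l -> lim u m -> l = m.
Proof.
move=> ul um; apply/eqP; rewrite -subr_eq0 -na_eq0 eq_le na_ge0 andbT leNgt.
apply/negP => e0; have [N ulN] := ul _ e0; have [M umM] := um _ e0.
have := na_sub_trans (u (maxn N M)) l m; rewrite leNgt => /negP; apply.
by rewrite gt_max naBC ulN ?umM ?leq_maxl ?leq_maxr.
Qed.

Lemma abs_lim_near u w l N :
  (forall n, (N <= n)%N -> u n = w n) -> lim u l -> lim w l.
Proof.
move=> uw ul eps e0; have [M uM] := ul _ e0.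
exists (maxn N M) => n; rewrite geq_max => /andP[Nn Mn].
by rewrite -uw ?uM.
Qed.

Lemma abs_lim_eq u w l : u =1 w -> lim u l -> lim w l.
Proof. by move=> uw; apply: (@abs_lim_near _ _ _ 0). Qed.

Lemma abs_lim_cst l : lim (fun=> l) l.
Proof. by move=> eps e0; exists 0 => n _; rewrite subrr na0. Qed.

Lemma abs_lim_sub u l (f : nat -> nat) :
  (forall n, (n <= f n)%N) -> lim u l -> lim (u \o f) l.
Proof.
move=> fn ul eps e0; have [N uN] := ul _ e0; exists N => n Nn /=.
by rewrite uN // (leq_trans Nn).
Qed.

Lemma abs_limB u w l m : lim u l -> lim w m -> lim (fun n => u n - w n) (l - m).
Proof.
move=> ul wm eps e0; have [N uN] := ul _ e0; have [M wM] := wm _ e0.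
exists (maxn N M) => n; rewrite geq_max => /andP[Nn Mn].
have -> : u n - w n - (l - m) = (u n - l) - (w n - m) by ring.
by apply: le_lt_trans (naB _ _) _; rewrite gt_max uN ?wM.
Qed.

Lemma abs_limM u w l m : lim u l -> lim w m -> lim (fun n => u n * w n) (l * m).
Proof.
move=> ul wm eps e0.
pose B := Num.max 1 (Num.max (abs l) (abs m)).
have B0 : 0 < B by rewrite lt_max ltr01.
have eB0 : 0 < eps / B by rewrite divr_gt0.
have [N uN] := ul _ eB0; have [M wM] := wm _ eB0; have [M' wM'] := wm _ B0.
exists (maxn N (maxn M M')) => n; rewrite !geq_max => /and3P[Nn Mn M'n].
have wB : abs (w n) <= B.
  rewrite -(subrK m (w n)) (le_trans (naD _ _)) // ge_max (ltW (wM' _ M'n)) /=.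
  by rewrite !le_max lexx !orbT.
have lB : abs l <= B by rewrite !le_max lexx !orbT.
apply: le_lt_trans (na_sub_trans (l * w n) _ _) _.
rewrite -mulrBl -mulrBr !naM gt_max; apply/andP; split.
  rewrite -(divfK (lt0r_neq0 B0) eps).
  by apply: le_lt_trans (ler_wpM2l (na_ge0 _) wB) _; rewrite ltr_pM2r // uN.
rewrite -(divfK (lt0r_neq0 B0) eps) mulrC.
by apply: le_lt_trans (ler_wpM2l (na_ge0 _) lB) _; rewrite ltr_pM2r // wM.
Qed.

Lemma abs_limX u l k : lim u l -> lim (fun n => u n ^+ k) (l ^+ k).
Proof.
move=> ul; elim: k => [|k IHk]; first exact: abs_lim_cst.
apply: (@abs_lim_eq (fun n => u n * u n ^+ k)) => [n|]; rewrite exprS //.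
exact: abs_limM.
Qed.

Lemma abs_lim_prod (I : Type) (r : seq I) (P : pred I) (u : I -> nat -> K)
    (l : I -> K) :
  (forall i, P i -> lim (u i) (l i)) ->
  lim (fun n => \prod_(i <- r | P i) u i n) (\prod_(i <- r | P i) l i).
Proof.
move=> ul; elim: r => [|i r IHr].
  by rewrite big_nil; apply: abs_lim_eq (abs_lim_cst 1) => n; rewrite big_nil.
rewrite big_cons; case: ifP => Pi.
  by apply: abs_lim_eq (abs_limM (ul i Pi) IHr) => n; rewrite big_cons Pi.
by apply: abs_lim_eq IHr => n; rewrite big_cons Pi.
Qed.

(** By the ultrametric inequality, [u m - u n] is no larger than the largest step in between. *)
Lemma abs_cauchy_steps u :
  (forall eps : R, 0 < eps ->
    exists N, forall n, (N <= n)%N -> abs (u n.+1 - u n) < eps) ->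
  abs_cauchy abs u.
Proof.
move=> us eps e0; have [N uN] := us _ e0; exists N => m n Nm Nn.
wlog mn : m n Nm Nn / (m <= n)%N.
  by have [mn|/ltnW nm] := leqP m n => [/(_ m n)|/(_ n m)]; [|rewrite naBC]; apply.
rewrite -(subnKC mn) naBC; elim: (n - m)%N => [|k IHk].
  by rewrite addn0 subrr na0.
apply: le_lt_trans (na_sub_trans (u (m + k)%N) _ _) _.
by rewrite gt_max IHk addnS uN // (leq_trans Nm) ?leq_addr.
Qed.

Lemma abs_lim_eq1 u l : lim u l -> (forall n, abs (u n) = 1) -> l != 0.
Proof.
move=> ul u1; apply/eqP => l0; have [N /(_ _ (leqnn N))] := ul _ ltr01.
by rewrite l0 subr0 u1 ltxx.
Qed.

End AbsoluteValue.

(** * The products over residue classes of indices *)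

Lemma expr_small (R : realType) (x eps : R) : 0 <= x < 1 -> 0 < eps ->
  exists N, forall n, (N <= n)%N -> x ^+ n < eps.
Proof.
move=> /andP[x0 x1] e0.
have [->|xn0] := eqVneq x 0.
  by exists 1%N => -[//|n _]; rewrite expr0n.
have xp : 0 < x by rewrite lt_def xn0.
pose h := x^-1 - 1; have h0 : 0 < h by rewrite subr_gt0 invf_gt1.
(* Bernoulli's inequality for [x^-1 = 1 + h]. *)
have bern n : 1 + n%:R * h <= x^-1 ^+ n.
  elim: n => [|n IHn]; first by rewrite mul0r addr0.
  have -> : x^-1 ^+ n.+1 = x^-1 ^+ n + h * x^-1 ^+ n.
    by rewrite exprS /h mulrBl mul1r addrC subrK.
  have : 1 <= x^-1 ^+ n by rewrite exprn_ege1 // ltW // invf_gt1.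
  rewrite -natr1; nra.
pose N := Num.bound (eps^-1 / h); exists N => n Nn.
rewrite -[eps]invrK -[x]invrK exprVn ltf_pV2 ?posrE ?invr_gt0 ?exprn_gt0 //;
  rewrite ?invr_gt0 //.
apply: lt_le_trans (bern n).
have : eps^-1 / h < N%:R.
  by apply: archi_boundP; rewrite divr_ge0 ?invr_ge0 ?ltW.
rewrite ltr_pdivrMr // => /lt_le_trans; apply.
by rewrite ler_wpDl ?ler01 // ler_wpM2r ?ler_nat // ltW.
Qed.

Section AlgebraicOverRMorphism.
Variables (K L : fieldType) (f : {rmorphism K -> L}).

Lemma algebraicOver_prod I (r : seq I) (P : pred I) (u : I -> L) :
  (forall i, P i -> algebraicOver f (u i)) ->
  algebraicOver f (\prod_(i <- r | P i) u i).
Proof. exact: (big_ind _ (algebraic1 f) (@algebraic_mul _ _ f)). Qed.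

Lemma algebraicOver_exp x n : algebraicOver f x -> algebraicOver f (x ^+ n).
Proof.
move=> fx; elim: n => [|n IHn]; first exact: algebraic1.
by rewrite exprS; apply: algebraic_mul.
Qed.

End AlgebraicOverRMorphism.

Section Gamma.
Variables (R : realType) (F : finFieldType) (p e : nat) (v : {poly F}).
Variable T : vadic_tower v R.
Hypotheses (p_prime : prime p) (cardF : #|F| = (p ^ e)%N).
Hypotheses (v_monic : v \is monic) (v_irr : irreducible_poly v).
Local Notation q := #|F|.
Local Notation A := {poly F}.
Local Notation d := (pdeg v).
Local Notation abs := (@kv_abs _ _ _ T).
Local Notation lim := (abs_lim abs).

Definition poly_kv : {rmorphism A -> kv T} := kv_in T \o @tofrac A.
Local Notation j := poly_kv.

Let absP : is_na_absval abs. Proof. by have [] := kv_completion T. Qed.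
Let abs_cpl : abs_complete abs. Proof. by have [] := kv_completion T. Qed.
Let absj a : abs (j a) = absv v R (tofrac a).
Proof. by have [_ + _ _] := kv_completion T => ->. Qed.
Let absj_le1 a : abs (j a) <= 1. Proof. by rewrite absj absv_le1. Qed.
Let absj_eq1 a : ~~ (v %| a) -> abs (j a) = 1.
Proof. by rewrite absj; apply: absv_eq1. Qed.

Local Notation pi := (abs (j v)).

Let pi01 : 0 <= pi < 1.
Proof. by rewrite na_ge0 //= absj absv_lt1 ?dvdpp. Qed.
Let pi_gt0 : 0 < pi.
Proof.
case/andP: pi01 => pi0 _; rewrite lt_def pi0 andbT na_eq0 //.
by rewrite fmorph_eq0 tofrac_eq0 monic_neq0.
Qed.

Let absj_dvd a : v %| a -> abs (j a) <= pi.
Proof.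
case/dvdpP => c ->; rewrite rmorphM naM //.
by rewrite ler_piMl // na_ge0.
Qed.

Let pi_le m n : (m <= n)%N -> pi ^+ n <= pi ^+ m.
Proof. by case/andP: pi01 => pi0 /ltW pi1 mn; rewrite ler_wiXn2l. Qed.

Let pchar_kv : p \in [pchar kv T].
Proof.
have := pchar_poly_card p_prime cardF.
by rewrite !inE => /andP[-> /eqP p0]; rewrite -(rmorph_nat j) p0 rmorph0 eqxx.
Qed.

Let exprB_kv n (a b : kv T) : (a - b) ^+ (q ^ n) = a ^+ (q ^ n) - b ^+ (q ^ n).
Proof. by rewrite cardF -expnM exprBn_pchar_exp. Qed.

Let exprN1_kv n : (-1 : kv T) ^+ (q ^ n) = -1.
Proof.
have := exprB_kv n 0 1; rewrite !sub0r expr1n expr0n expn_eq0.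
by rewrite -leqn0 leqNgt (ltnW (finNzRing_gt1 F)) /= sub0r.
Qed.

Let q_ge2 : (2 <= q)%N. Proof. exact: finNzRing_gt1. Qed.

Let q_exp_gt n : (n < q ^ n)%N. Proof. exact: ltn_expl. Qed.

(** By [dvdp_bracket_sq], [v] divides the bracket at most once. *)
Lemma abs_bracket_ge n : (0 < n)%N -> pi <= abs (j (bracket F n)).
Proof.
move=> n0; have [vn|vn] := boolP (v %| bracket F n); last first.
  by rewrite (absj_eq1 vn); case/andP: pi01 => _ /ltW.
have := dvdp_bracket_sq p_prime cardF v_monic v_irr n0.
case/dvdpP: vn => c ->; rewrite expr2 dvdp_mul2r ?(monic_neq0 v_monic) // => vc.
by rewrite rmorphM naM // (absj_eq1 vc) mul1r.
Qed.

Definition Dkv i : kv T := - j (Dv v i).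

Lemma abs_Dkv i : abs (Dkv i) = 1.
Proof.
rewrite naN // rmorph_prod /=; apply: na_prod_eq1 => // a /and3P[_ _ va].
exact: absj_eq1.
Qed.

Lemma Dkv_neq0 i : Dkv i != 0.
Proof. by rewrite -(na_eq0 absP) abs_Dkv oner_eq0. Qed.

(* With [y = Dkv], [Dv_rec] reads [y_(m+1) = y_m ^ q * r_m] where
   [r_m = bracket (m + 1) / bracket (m + 1 - d)] tends to 1; Wilson's theorem in
   [A / v] starts the induction at [m = d]. *)
Lemma abs_Dkv_sub1 k : abs (Dkv (d + k) - 1) <= pi ^+ (k.-1.+1).
Proof.
(* The exponent is [max(k, 1)]: Wilson's theorem gives one factor [pi] at [k = 0], and the estimate
   of [r - 1] gives [k + 1] of them at [k + 1]. *)
elim: k => [|k IHk].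
  rewrite addn0 naBC // opprK -(rmorph1 j) -rmorphD addrC expr1.
  by rewrite absj_dvd // (dvdp_Dv_wilson v_monic v_irr).
pose m := (d + k)%N.
have dm : (d <= m)%N := leq_addr _ _.
have mk : (m.+1 - d = k.+1)%N by rewrite -addnS addKn.
have B0 : j (bracket F k.+1) != 0.
  by rewrite -(na_eq0 absP) gt_eqF // (lt_le_trans pi_gt0) ?abs_bracket_ge.
pose r := j (bracket F m.+1) / j (bracket F k.+1).
have rE : Dkv m.+1 = Dkv m ^+ q * r.
  have := congr1 j (Dv_rec p_prime cardF v_monic dm).
  rewrite mk !rmorphM rmorphXn /= => eD; apply: (mulIf B0).
  rewrite mulNr eD /r mulrA divfK // /Dkv -[- j (Dv v m)]mulN1r exprMn.
  by have := exprN1_kv 1; rewrite expn1 => ->; rewrite mulN1r mulNr mulrC.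
(* By Frobenius the two brackets differ by [bracket d ^+ (q ^ k.+1)], of absolute value at most
   [pi ^+ k.+2]; the denominator costs at most one factor [pi]. *)
have r1 : abs (r - 1) <= pi ^+ k.+1.
  have -> : r - 1 = j (bracket F d) ^+ (q ^ k.+1) / j (bracket F k.+1).
    rewrite -[1](divff B0) -mulrBl; congr (_ / _).
    rewrite -rmorphB -rmorphXn; congr (j _).
    rewrite /bracket (exprB_card p_prime cardF) -exprM -expnD opprB addrA subrK.
    by rewrite -addnS.
  rewrite naM // naX //.
  have -> : abs (j (bracket F k.+1))^-1 = (abs (j (bracket F k.+1)))^-1.
    have B0' : abs (j (bracket F k.+1)) != 0 by rewrite na_eq0.
    by apply: (mulfI B0'); rewrite -naM // !divff // na1.
  rewrite ler_pdivrMr; last by rewrite (lt_le_trans pi_gt0) ?abs_bracket_ge.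
  have : pi ^+ k.+2 <= pi ^+ k.+1 * abs (j (bracket F k.+1)).
    by rewrite exprSr ler_wpM2l ?exprn_ge0 ?na_ge0 // abs_bracket_ge.
  apply: le_trans; apply: le_trans (pi_le (q_exp_gt k.+1)).
  rewrite lerXn2r ?nnegrE ?na_ge0 // absj_dvd //.
  exact: dvdp_bracket_place.
rewrite addnS rE.
have -> : Dkv m ^+ q * r - 1 = Dkv m ^+ q * (r - 1) + (Dkv m - 1) ^+ q.
  have := exprB_kv 1 (Dkv m) 1; rewrite expn1 expr1n => ->; ring.
apply: le_trans (naD absP _ _) _; rewrite ge_max; apply/andP; split.
  by rewrite naM // naX // abs_Dkv expr1n mul1r.
rewrite naX // /=; apply: (@le_trans _ _ ((pi ^+ k.-1.+1) ^+ q)).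
  by rewrite lerXn2r ?nnegrE ?exprn_ge0 ?na_ge0.
rewrite -exprM; apply: pi_le.
case: k {IHk m dm mk B0 r rE r1} => [|k] /=; first by rewrite mul1n ltnW.
by rewrite (leq_trans _ (leq_mul (leqnn k.+1) q_ge2)) // muln2 -addnn addSnnS; lia.
Qed.

Lemma abs_lim_Dkv : lim Dkv 1.
Proof.
move=> eps e0; have [N piN] := expr_small pi01 e0.
exists (d + N).+1 => n Nn; rewrite -(subnKC (leq_trans (leq_addr N d) (ltnW Nn))).
apply: le_lt_trans (abs_Dkv_sub1 _) _; apply: piN; lia.
Qed.

Definition class_prod (m c n : nat) : kv T := \prod_(i < n | (i %% m == c)%N) Dkv i.

Lemma abs_class_prod m c n : abs (class_prod m c n) = 1.
Proof. by apply: na_prod_eq1 => // i _; exact: abs_Dkv. Qed.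

Lemma class_prodS m c n :
  class_prod m c n.+1 = class_prod m c n * (if (n %% m == c)%N then Dkv n else 1).
Proof. by rewrite /class_prod big_mkcond big_ord_recr -big_mkcond. Qed.

(** The [G_m(c)] of the introduction; the limit exists by [abs_lim_class], so the default 0 is never
    taken. *)
Definition class_lim m c : kv T :=
  xget 0 [set l : kv T | lim (class_prod m c) l]%classic.

Lemma abs_lim_class m c : lim (class_prod m c) (class_lim m c).
Proof.
have [l ul] : exists l, lim (class_prod m c) l; last first.
  by rewrite /class_lim; case: xgetP => // /(_ l).
apply: abs_cpl; apply: abs_cauchy_steps => // eps e0.
have [N DN] := abs_lim_Dkv e0; exists N => n Nn.
rewrite class_prodS -[X in _ - X]mulr1 -mulrBr naM // abs_class_prod mul1r.
by case: ifP => _; rewrite ?DN // subrr na0.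
Qed.

Lemma class_lim_neq0 m c : class_lim m c != 0.
Proof.
by apply: (abs_lim_eq1 (abs_lim_class m c)) => n; exact: abs_class_prod.
Qed.

Lemma class_prod_sub c n : (c < d)%N ->
  class_prod d c (c + n * d).+1 = \prod_(r < n.+1) Dkv (c + r * d).
Proof.
(* Between consecutive indices congruent to [c] modulo [d] the partial product is constant. *)
move=> cd; have skip k a : (forall i, (i < k)%N -> (a + i) %% d != c)%N ->
    class_prod d c (a + k) = class_prod d c a.
  elim: k => [|k IHk] ak; first by rewrite addn0.
  rewrite addnS class_prodS (negPf (ak _ _)) // mulr1 IHk // => i ik.
  by apply: ak; rewrite leqW.
elim: n => [|n IHn].
  rewrite big_ord1 !mul0n !addn0 class_prodS modn_small // eqxx.
  rewrite -[c in class_prod d c c]add0n skip; last first.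
    by move=> i ic; rewrite add0n modn_small ?ltn_eqF // (ltn_trans ic).
  by rewrite /class_prod big_ord0 mul1r.
rewrite big_ord_recr /= -IHn class_prodS [(c + n.+1 * d)%N]addnC modnMDl.
rewrite modn_small // eqxx [(n.+1 * d + c)%N]addnC; congr (_ * _).
have -> : (c + n.+1 * d = (c + n * d).+1 + d.-1)%N.
  by rewrite mulSn; have := pdeg_place_gt0 v_monic v_irr; lia.
apply: skip => i id1; rewrite addSnnS [(c + _)%N]addnC -addnA modnMDl.
have [h|h] := ltnP (c + i.+1) d; first by rewrite modn_small //; lia.
rewrite -(subnK h) modnDr modn_small; lia.
Qed.

(** [prod_Dv_rec] with signs: the left side has one more factor and [(-1) ^+ (q ^ d) = -1], so a
    single minus sign survives. *)
Lemma class_prod_rec c n : (c < d)%N ->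
  class_prod d c (c + n.+1 * d).+1 * j v ^+ (q ^ c) =
  - class_prod d c (c + n * d).+1 ^+ (q ^ d)
    * \prod_(s < d) j (bracket F (c + n.+1 * d - s)) ^+ (q ^ s).
Proof.
move=> cd; have jprod m : \prod_(r < m) Dkv (c + r * d)
    = (-1) ^+ m * j (\prod_(r < m) Dv v (c + r * d)).
  by rewrite rmorph_prod prodrN card_ord.
rewrite !class_prod_sub // !jprod -mulrA -rmorphXn -rmorphM.
rewrite (prod_Dv_rec p_prime cardF v_monic n cd) rmorphM rmorphXn.
rewrite exprMn [_ ^+ _ ^+ (q ^ d)]exprAC exprN1_kv exprS mulN1r !mulNr mulrA.
congr (- (_ * _)); rewrite rmorph_prod; apply: eq_bigr => s _.
exact: rmorphXn.
Qed.

(** Successive terms differ by [bracket d ^+ (q ^ (n * d))], which tends to 0 because [v] divides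
    [bracket d]. The power [q ^ d] shifts the sequence by one, hence fixes its limit. *)
Lemma teichmuller_lim : exists2 w : kv T,
  lim (fun n => j ('X^(q ^ (n * d)))) w & w ^+ (q ^ d) = w.
Proof.
have [w wP] : exists w, lim (fun n => j ('X^(q ^ (n * d)))) w.
  apply: abs_cpl; apply: abs_cauchy_steps => // eps e0.
  have [N piN] := expr_small pi01 e0; exists N => n Nn.
  have -> : j 'X^(q ^ (n.+1 * d)) - j 'X^(q ^ (n * d))
      = j (bracket F d) ^+ (q ^ (n * d)).
    rewrite -rmorphB -rmorphXn /bracket (exprB_card p_prime cardF).
    by rewrite -exprM -expnD mulSn.
  rewrite naX //; apply: le_lt_trans (piN _ Nn).
  apply: (@le_trans _ _ (pi ^+ (q ^ (n * d)))).
    rewrite lerXn2r ?nnegrE ?na_ge0 // absj_dvd //.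
    exact: dvdp_bracket_place.
  apply: pi_le; apply: leq_trans (ltnW (q_exp_gt _)).
  by rewrite leq_pmulr // (pdeg_place_gt0 v_monic v_irr).
exists w => //; apply: (abs_lim_unique absP (abs_limX absP (q ^ d) wP)).
apply: (abs_lim_eq _ (abs_lim_sub (f := succn) _ wP)) => [n /=|//].
by rewrite -[RHS](rmorphXn j) -exprM -expnD mulSn addnC.
Qed.

(* In the limit, [class_prod_rec] says that [G = class_lim d c] satisfies
   [G * v ^ (q ^ c) = - G ^ (q ^ d) * k], where [k] is a polynomial in 'X and
   the Teichmueller representative [w] of 'X. *)
Lemma algebraic_class_lim c : (c < d)%N ->
  algebraicOver (kv_in T) (class_lim d c).
Proof.
move=> cd; have [w wP w_fix] := teichmuller_lim.
have w_alg : algebraicOver (kv_in T) w.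
  exists ('X^(q ^ d) - 'X).
    rewrite -size_poly_gt0 size_polyDl size_polyXn // size_polyN size_polyX.
    rewrite ltnS (leq_ltn_trans _ (q_exp_gt d)) //.
    exact: pdeg_place_gt0.
  by rewrite rmorphB rmorphXn /= map_polyX rootE !hornerE w_fix subrr.
(* The limit of the brackets in [class_prod_rec]: ['X^(q ^ (c + n.+1 * d - s))] is the power
   [q ^ (c + d - s)] of ['X^(q ^ (n * d))], which tends to [w]. *)
pose k := \prod_(s < d) (w ^+ (q ^ (c + d - s)) - j 'X) ^+ (q ^ s).
have k_alg : algebraicOver (kv_in T) k.
  apply: algebraicOver_prod => s _; apply/algebraicOver_exp/algebraic_sub.
    exact: algebraicOver_exp.
  exact: (algebraic_id (kv_in T) (tofrac 'X)).
pose G := class_lim d c.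
have fP : forall n, (n <= (c + n * d).+1)%N.
  move=> n; apply: leqW; apply: leq_trans (leq_addl _ _).
  by rewrite leq_pmulr // (pdeg_place_gt0 v_monic v_irr).
have GE : G * j v ^+ (q ^ c) = -1 * (G ^+ (q ^ d) * k).
  apply: (abs_lim_unique absP (abs_limM absP _ (abs_lim_cst absP _))).
    apply: (abs_lim_sub (f := fun n => (c + n.+1 * d).+1) _ (abs_lim_class d c)).
    by move=> n; apply: leq_trans (fP n.+1).
  apply: (@abs_lim_eq _ _ _ (fun n => -1 * (class_prod d c (c + n * d).+1 ^+ (q ^ d)
    * \prod_(s < d) (j 'X^(q ^ (n * d)) ^+ (q ^ (c + d - s)) - j 'X) ^+ (q ^ s)))).
    move=> n /=; rewrite class_prod_rec // mulN1r mulNr; congr (- (_ * _)).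
    apply: eq_bigr => s _; congr (_ ^+ _); rewrite /bracket rmorphB.
    congr (_ - _); rewrite -[LHS](rmorphXn j) -exprM -expnD; congr (j 'X^(q ^ _)).
    by rewrite mulSn; have := ltn_ord s; lia.
  apply: (abs_limM absP (abs_lim_cst absP _)); apply: (abs_limM absP).
    exact: (abs_limX absP) (abs_lim_sub fP (abs_lim_class d c)).
  apply: (abs_lim_prod absP) => s _; apply: (abs_limX absP).
  apply: (abs_limB absP) (abs_lim_cst absP _); exact: (abs_limX absP).
(* [G] is a root of [P], whose coefficients are algebraic over [k]; [P] is nonzero because, as
   [1 < q ^ d], its linear coefficient is the power of [v]. *)
pose P := k *: 'X^(q ^ d) + (j v ^+ (q ^ c)) *: 'X.
apply/integral_algebraic; apply: (@integral_root _ _ _ P).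
- apply/eqP => /(congr1 (fun Q : {poly _} => Q`_1)).
  rewrite coefD !coefZ coefXn coefX eqxx mulr1 coef0 ltn_eqF; last first.
    by rewrite (leq_ltn_trans (pdeg_place_gt0 v_monic v_irr)).
  rewrite mulr0 add0r => /eqP; rewrite expf_eq0 => /andP[_].
  by rewrite -(na_eq0 absP) gt_eqF.
- by rewrite rootE !hornerE [_ * G]mulrC GE mulN1r mulrC subrr.
- apply/integral_poly => i; rewrite coefD !coefZ coefXn coefX.
  apply/integral_algebraic/algebraic_add; apply: algebraic_mul => //.
  + by apply/integral_algebraic/integral_nat.
  + by apply: algebraicOver_exp; exact: (algebraic_id (kv_in T) (tofrac v)).
  + by apply/integral_algebraic/integral_nat.
Qed.

End Gamma.

(** * Digits of p-adic integers *)

Section Digits.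
Variables (p e l : nat).
Hypotheses (p_gt1 : (1 < p)%N) (e_gt0 : (0 < e)%N) (l_gt0 : (0 < l)%N).
Variable x : padic_int p.
Local Notation q := (p ^ e)%N.
Local Notation X i := (x (e * i)%N).
Local Notation digit := (qdigit e x).

Let q_gt1 : (1 < q)%N.
Proof. by rewrite -(exp1n e) ltn_exp2r. Qed.

Let qn_gt0 n : (0 < q ^ n)%N. Proof. by rewrite expn_gt0 ltnW. Qed.

Lemma padic_mod_add n k : x n = (x (n + k) %% p ^ n)%N.
Proof.
elim: k => [|k IHk].
  by rewrite addn0 modn_small // padic_modP ltn_mod expn_gt0 ltnW.
by rewrite IHk (padic_modP x (n + k)) addnS modn_dvdm // dvdn_exp2l // leq_addr.
Qed.

Let X_lt i : (X i < q ^ i)%N.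
Proof. by rewrite padic_modP -expnM ltn_mod expn_gt0 ltnW. Qed.

Let X_mod i k : (i <= k)%N -> X i = (X k %% q ^ i)%N.
Proof.
move=> ik; rewrite (padic_mod_add (e * i) (e * (k - i))) -mulnDr subnKC //.
by rewrite -expnM.
Qed.

Lemma qdigitE i k : (i < k)%N -> digit i = ((X k %/ q ^ i) %% q)%N.
Proof. by move=> ik; rewrite /qdigit (X_mod ik) expnS modn_divl. Qed.

(* With [(q^l - 1) x = b] and [k i] the integer [((q^l - 1) (x mod q^i) - b) / q^i],
   the next [l] digits of [x] spell [k i], and [k (i + l) = k i]. *)
Lemma qdigit_periodic (b : int) (k : nat -> nat) N :
  (forall i, (N <= i)%N -> (k i < q ^ l)%N
     /\ (q ^ l)%:Z * (X i)%:Z - (X i)%:Z - b = (k i)%:Z * (q ^ i)%:Z) ->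
  (forall i, (N <= i)%N -> (X (i + l) %/ q ^ i)%N = k i) /\
  (forall i, (N <= i)%N -> digit (i + l) = digit i).
Proof.
move=> kP.
have step i : (N <= i)%N -> (X (i + l) %/ q ^ i)%N = k i /\ k (i + l) = k i.
  move=> Ni; have [k_lt kE] := kP _ Ni.
  have [k'_lt k'E] := kP _ (leq_trans Ni (leq_addr l i)).
  have XE := divn_eq (X (i + l)) (q ^ i).
  rewrite -(X_mod (leq_addr l i)) in XE.
  have W_lt : (X (i + l) %/ q ^ i < q ^ l)%N.
    by rewrite ltn_divLR // -expnD addnC X_lt.
  move: (X (i + l) %/ q ^ i)%N W_lt XE => W W_lt XE.
  have kW : (k i)%:Z - W%:Z = ((k (i + l))%:Z - W%:Z) * (q ^ l)%:Z.
    have qi0 : (q ^ i)%:Z != 0 by rewrite -lt0n.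
    apply: (mulIf qi0); move: k'E; rewrite XE expnD !PoszM PoszD !PoszM => k'E.
    rewrite [LHS]mulrBl -kE.
    transitivity ((k (i + l))%:Z * ((q ^ i)%:Z * (q ^ l)%:Z)
      - W%:Z * (q ^ l)%:Z * (q ^ i)%:Z); last by ring.
    by rewrite -k'E; ring.
  (* [k i] and [W] both lie in [[0, q^l)], so their difference, a multiple of [q^l], is 0. *)
  have kW0 : (k (i + l))%:Z - W%:Z = 0.
    move: kW k_lt W_lt; move: (q ^ l)%N (k i) (k (i + l)) => Q0 k0 k1 kW k_lt W_lt.
    nia.
  by move: kW; rewrite kW0 mul0r => kW; split; lia.
split=> i Ni; first by have [] := step _ Ni.
have [Wi ki] := step _ Ni; have [Wi' _] := step _ (leq_trans Ni (leq_addr l i)).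
have lt_l i0 : (i0 < i0 + l)%N by rewrite -{1}[i0]addn0 ltn_add2l.
by rewrite (qdigitE (lt_l i)) (qdigitE (lt_l (i + l)%N)) Wi Wi' ki.
Qed.

Lemma qdigit_eventually_periodic (b : int) :
  (forall n, ((p ^ n)%:Z %| (q ^ l)%:Z * (x n)%:Z - (x n)%:Z - b)%Z) ->
  exists N, forall i, (N <= i)%N -> digit (i + l) = digit i.
Proof.
(* For [i >= N] one has [|b| < q^i], which places the quotient by [q^i] in [[0, q^l)]. *)
move=> xb; pose N := `|b|%N.+1.
suff /choice[k kP] : forall i, exists k : nat, (N <= i)%N -> (k < q ^ l)%N /\
    (q ^ l)%:Z * (X i)%:Z - (X i)%:Z - b = k%:Z * (q ^ i)%:Z.
  by exists N; have [] := qdigit_periodic kP.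
move=> i; have /dvdzP[k kE] := xb (e * i)%N; exists `|k|%N => Ni.
have b_lt : (`|b| < q ^ i)%N by rewrite (leq_trans _ (ltnW (ltn_expl i q_gt1))).
have := X_lt i; move: kE b_lt; rewrite expnM.
move: (X i) (q ^ i)%N (q ^ l)%N (qn_gt0 l) => Xi qi ql ql0 kE b_lt Xi_lt.
have k0 : 0 <= k by nia.
have kq : k < ql by nia.
by split; [lia|rewrite kE; lia].
Qed.

(** The hypothesis says that [x = q^c / (1 - q^l)], the sum of the [q^(c + i l)]. Since [c < l],
    [qdigit_periodic] applies from [N = 0] on. *)
Lemma qdigit_indicator c : (c < l)%N ->
  (forall n, ((p ^ n)%:Z %| (q ^ l)%:Z * (x n)%:Z - (x n)%:Z + (q ^ c)%:Z)%Z) ->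
  forall i, digit i = (i %% l == c)%N.
Proof.
move=> cl xb.
suff /choice[k kP] : forall i, exists k : nat, (0 <= i)%N -> (k < q ^ l)%N /\
    (q ^ l)%:Z * (X i)%:Z - (X i)%:Z - - (q ^ c)%:Z = k%:Z * (q ^ i)%:Z.
  have [W per] := qdigit_periodic kP.
  (* [X 0 = 0] forces [k 0 = q ^ c], so the first [l] digits spell [q ^ c]. *)
  have Xl : X l = (q ^ c)%N.
    have := W 0%N isT; rewrite add0n expn0 divn1 => ->.
    have [_] := kP 0%N isT; have := X_lt 0%N; rewrite expn0 muln0.
    by rewrite ltnS leqn0 => /eqP ->; lia.
  have per_mod i : digit i = digit (i %% l).
    rewrite {1}(divn_eq i l) addnC; elim: (i %/ l)%N => [|n IHn].
      by rewrite addn0.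
    by rewrite mulSn addnCA addnC per.
  move=> i; rewrite per_mod; move: (i %% l)%N (ltn_pmod i l_gt0) => {}i il.
  rewrite (qdigitE il) Xl; case: ltngtP => ic.
  - rewrite -(subnK (ltnW ic)) expnD mulnK //.
    by rewrite -[(c - i)%N]prednK ?subn_gt0 // expnS modnMr.
  - by rewrite divn_small ?mod0n // ltn_exp2l.
  - by rewrite ic divnn qn_gt0 modn_small.
move=> i; have /dvdzP[k kE] := xb (e * i)%N; exists `|k|%N => _.
have c_lt : (q ^ c < q ^ l)%N by rewrite ltn_exp2l.
have := X_lt i; move: kE; rewrite opprK expnM.
move: (X i) (q ^ i)%N (q ^ c)%N (q ^ l)%N (qn_gt0 c) c_lt.
move=> Xi qi qc ql qc0 c_lt kE Xi_lt.
have k0 : 0 <= k by nia.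
have kq : k < ql by nia.
by split; [lia|rewrite kE; lia].
Qed.

End Digits.

(** Modulo [p ^ n], [x + 1] is the image of [z], whence [(a - 1) x = b - (a - 1)]. The denominator
    of [z] divides [a - 1], so it is prime to [p] and that image is the genuine one. *)
Lemma padic_pred_ratE (p a : nat) (z : rat) (b : int) n
    (x := padic_pred (padic_of_rat p z) n) :
  prime p -> (p %| a)%N -> (a%:R - 1) * z = b%:~R ->
  ((p ^ n)%:Z %| a%:Z * x%:Z - x%:Z - (b - a%:Z + 1))%Z.
Proof.
move=> p_prime pa zb; have p0 : (0 < p)%N := prime_gt0 p_prime.
have bE : (a%:Z - 1) * numq z = b * denq z.
  apply: (intr_inj (R := rat)); rewrite !rmorphM rmorphB /= -zb -mulrA.
  by rewrite -numqE.
have /dvdzP[c cE] : (denq z %| a%:Z - 1)%Z.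
  rewrite -(@Gauss_dvdzl _ _ (numq z)); last first.
    by rewrite coprimez_sym coprimezE coprime_num_den.
  by rewrite bE dvdz_mull.
have cb : c * numq z = b.
  by apply: (mulfI (denq_neq0 z)); rewrite mulrA [denq z * c]mulrC -cE bE mulrC.
have cop : coprime p `|denq z|.
  rewrite prime_coprime //; apply/negP => pz.
  have : (p%:Z %| a%:Z - (a%:Z - 1))%Z.
    by rewrite rpredB ?dvdzE //= cE abszM dvdn_mull.
  by rewrite subKr dvdzE /= dvdn1; case: p p_prime {p0 pa x pz} => [|[]].
have /eqP := padic_of_rat_seqE n p0 cop; rewrite eqz_mod_dvd => s_dvd.
set s := padic_of_rat_seq p z n in s_dvd.
have pn0 : (0 < p ^ n)%N by rewrite expn_gt0 p0.
have xs : ((p ^ n)%:Z %| x%:Z + 1 - s%:Z)%Z.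
  rewrite -eqz_mod_dvd -PoszD !modz_nat eqz_nat /x /= /padic_pred_seq -/s.
  by rewrite modnDml -addnA addn1 prednK // modnDr.
have -> : a%:Z * x%:Z - x%:Z - (b - a%:Z + 1)
    = (a%:Z - 1) * (x%:Z + 1 - s%:Z) + c * (denq z * s%:Z - numq z).
  have -> : c * (denq z * s%:Z - numq z) = (a%:Z - 1) * s%:Z - b.
    by rewrite -cb cE; ring.
  by ring.
by rewrite rpredD // dvdz_mull.
Qed.

(** * Relations among the gamma values *)

Section Relations.
Variables (R : realType) (F : finFieldType) (p e : nat) (v : {poly F}).
Variable T : vadic_tower v R.
Hypotheses (p_prime : prime p) (cardF : #|F| = (p ^ e)%N).
Hypotheses (v_monic : v \is monic) (v_irr : irreducible_poly v).
Local Notation abs := (@kv_abs _ _ _ T).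
Local Notation lim := (abs_lim abs).

Let absP : is_na_absval abs. Proof. by have [] := kv_completion T. Qed.

Let lim_class m c : lim (class_prod T m c) (class_lim T m c).
Proof. exact: abs_lim_class p_prime cardF v_monic v_irr m c. Qed.

Lemma prod_mod_classes (m n : nat) (f : nat -> nat) : (0 < m)%N ->
  \prod_(i < n) Dkv T i ^+ f (i %% m)%N
  = \prod_(r < m) class_prod T m r n ^+ f r.
Proof.
move=> m0; pose r_of (i : 'I_n) := Ordinal (ltn_pmod i m0).
rewrite (partition_big r_of xpredT) //=; apply: eq_bigr => r _.
rewrite -prodrXl; apply: eq_bigr => i.
by rewrite -val_eqE /= => /eqP ->.
Qed.

(** A class modulo [g] is a disjoint union of classes modulo [m], so the finite products agree.
    Applied with [m = l] and with [m = deg v]. *)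
Lemma prod_class_lim g m b : (0 < g)%N -> (g %| m)%N -> (0 < m)%N -> (b < g)%N ->
  \prod_(r < m | (r %% g == b)%N) class_lim T m r = class_lim T g b.
Proof.
move=> g0 gm m0 bg; apply: (abs_lim_unique absP) (lim_class g b).
have := abs_lim_prod absP (index_enum 'I_m)
  (P := fun r : 'I_m => (r %% g == b)%N) (fun r _ => lim_class m r).
apply: abs_lim_eq => n.
have e0 := prod_mod_classes n (fun r => (r %% g == b)%N) m0.
rewrite big_mkcond [RHS]big_mkcond /=.
transitivity (\prod_(i < n) Dkv T i ^+ (i %% m %% g == b)%N).
  by rewrite e0; apply: eq_bigr => r _; case: eqP; rewrite ?expr1.
by apply: eq_bigr => i _; rewrite modn_dvdm //; case: eqP; rewrite ?expr1.
Qed.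

Lemma algebraic_class_lim_gcd l b : (0 < l)%N -> (b < gcdn l (pdeg v))%N ->
  algebraicOver (kv_in T) (class_lim T (gcdn l (pdeg v)) b).
Proof.
move=> l0 bg; have d0 := pdeg_place_gt0 v_monic v_irr.
rewrite -(prod_class_lim _ (dvdn_gcdr l (pdeg v))) ?gcdn_gt0 ?l0 //.
apply: algebraicOver_prod => r _.
exact: (algebraic_class_lim T p_prime cardF v_monic v_irr (ltn_ord r)).
Qed.

(** The periodic exponents are read at [r + N * l], an index past [N]; the element [k] corrects the
    finitely many factors before [N]. *)
Lemma lim_periodic (c : nat -> nat) l N : (0 < l)%N ->
  (forall i, (N <= i)%N -> c (i + l)%N = c i) ->
  exists k : {fraction {poly F}}, lim (fun n => \prod_(i < n) Dkv T i ^+ c i)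
    (kv_in T k * \prod_(r < l) class_lim T l r ^+ c (r + N * l)%N).
Proof.
move=> l0 cP; have c_add i k : (N <= i)%N -> c (i + k * l)%N = c i.
  move=> Ni; elim: k => [|k IHk]; first by rewrite addn0.
  by rewrite mulSn addnCA addnC cP // (leq_trans Ni) ?leq_addr.
have c_mod i : (N <= i)%N -> c i = c (i %% l + N * l)%N.
  move=> Ni; rewrite -(c_add i N) // {1}(divn_eq i l) -addnA addnC c_add //.
  by rewrite (leq_trans _ (leq_addl _ _)) // leq_pmulr.
pose f r := c (r + N * l)%N; pose D i : {fraction {poly F}} := - tofrac (Dv v i).
pose k := \prod_(i < N) (D i ^+ c i / D i ^+ f (i %% l)%N).
have D0 i : D i != 0.
  by have := Dkv_neq0 T v_irr i; rewrite -(fmorph_eq0 (kv_in T)) rmorphN.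
exists k; apply: (abs_lim_near (N := N)); last first.
  apply: (abs_limM absP (abs_lim_cst absP _)).
  by apply: (abs_lim_prod absP) => r _; apply: (abs_limX absP).
move=> n Nn /=; rewrite -(prod_mod_classes n f l0) -(subnKC Nn).
elim: (n - N)%N => [|m IHm]; last first.
  rewrite addnS 2!big_ord_recr /= mulrA IHm; congr (_ * _ ^+ _).
  by rewrite /f -c_mod // leq_addr.
rewrite addn0 rmorph_prod -big_split /=; apply: eq_bigr => i _.
rewrite fmorph_div !rmorphXn !rmorphN /= -/(Dkv T i) divfK //.
by rewrite expf_neq0 // Dkv_neq0.
Qed.

Lemma gamma_ariE (x : padic_int p) L :
  lim (fun n => \prod_(i < n) Dkv T i ^+ qdigit e (padic_pred x) i) L ->
  gamma_ari T e x = L.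
Proof.
move=> xL; rewrite /gamma_ari; case: xgetP => [l _ /= lP|/(_ L)//].
exact: (abs_lim_unique absP) lP xL.
Qed.

End Relations.

Section Kbar.
Variables (R : realType) (F : finFieldType) (v : {poly F}) (T : vadic_tower v R).

(** [kv_to_Cv] and [k_to_Cv] bundled as morphisms. *)
Definition kv_Cv : {rmorphism kv T -> Cv T} := Cv_in T \o kvbar_in T.
Definition k_Cv : {rmorphism {fraction {poly F}} -> Cv T} := kv_Cv \o kv_in T.

Lemma kbarP x : reflect (algebraicOver k_Cv x) (x \in kbar T).
Proof. exact: asboolP. Qed.

Lemma kbar_divring_closed : GRing.divring_closed (kbar T).
Proof.
split=> [|x y /kbarP xk /kbarP yk|x y /kbarP xk /kbarP yk]; apply/kbarP.
- exact: algebraic1.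
- exact: algebraic_sub.
- exact: algebraic_div.
Qed.

HB.instance Definition _ :=
  GRing.isDivringClosed.Build (Cv T) (kbar T) kbar_divring_closed.

Lemma kv_Cv_kbar y : algebraicOver (kv_in T) y -> kv_Cv y \in kbar T.
Proof.
case=> P P0 Py; apply/kbarP; exists P => //.
by rewrite -[map_poly _ _]/(map_poly (kv_Cv \o kv_in T) P) map_poly_comp fmorph_root.
Qed.

End Kbar.

(** * The bound, from the generators [G_l(g), ..., G_l(l-1)] *)

Theorem theorem2p8 (R : realType) (p e : nat) (F : finFieldType)
    (v : {poly F}) (T : vadic_tower v R) (l : nat)
    (p_prime : prime p) (e_gt0 : (0 < e)%N) (cardF : #|F| = (p ^ e)%N)
    (v_monic : v \is monic) (v_irr : irreducible_poly v) (l_gt0 : (0 < l)%N) :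
  exists2 d : nat,
    has_trdeg (kbar T) (adjoin (kbar T) (gamma_values T p e l)) d
    & (d <= l - gcdn l (pdeg v))%N.
Proof.
set g := gcdn l (pdeg v); have p_gt1 := prime_gt1 p_prime.
have g_gt0 : (0 < g)%N by rewrite gcdn_gt0 l_gt0.
have gl : (g %| l)%N := dvdn_gcdl _ _.
have g_le : (g <= l)%N := dvdn_leq l_gt0 gl.
have p_dvd : (p %| (p ^ e) ^ l)%N by rewrite -expnM dvdn_exp // muln_gt0 e_gt0.
pose G c := kv_Cv T (class_lim T l c).
pose s := [seq G c | c <- iota g (l - g)].
have -> : (l - g)%N = size s by rewrite size_map size_iota.
apply: has_trdeg_le => [_ /mapP[c c_s ->]|y /asboolP[z zP ->]].
  have cl : (c < l)%N.
    by move: c_s; rewrite mem_iota (subnKC g_le) => /andP[].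
  apply: sub_adjoinr; apply/asboolP.
  pose a : rat := (#|F| ^ l)%:R - 1.
  have a0 : a != 0.
    rewrite /a subr_eq0 pnatr_eq1 cardF -expnM gtn_eqF //.
    by apply: leq_ltn_trans (ltn_expl (e * l) p_gt1); rewrite muln_gt0 e_gt0.
  (* Chosen so that [b / a - 1 = - q^c / (q^l - 1)], whose digits are 1 at the indices congruent to
     [c] modulo [l] and 0 elsewhere. *)
  pose b : int := ((p ^ e) ^ l)%:Z - 1 - ((p ^ e) ^ c)%:Z.
  exists (b%:~R / a); first by rewrite mulrC divfK // intr_int.
  congr (kv_Cv T _); symmetry; apply: gamma_ariE => //.
  have digit := @qdigit_indicator p e l p_gt1 e_gt0 l_gt0 _ _ cl _.
  apply: abs_lim_eq (abs_lim_class T p_prime cardF v_monic v_irr l c) => n.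
  rewrite /class_prod big_mkcond; apply: eq_bigr => i _.
  rewrite digit => [|m]; first by case: eqP.
  have := @padic_pred_ratE p _ (b%:~R / a) b m p_prime p_dvd.
  rewrite -cardF -/a mulrC divfK // => /(_ erefl).
  by rewrite /b cardF; congr (is_true (_ %| _)%Z); ring.
have /intrP[b zb] := zP.
have [N per] : exists N, forall i, (N <= i)%N ->
    qdigit e (padic_pred (padic_of_rat p z)) (i + l)
    = qdigit e (padic_pred (padic_of_rat p z)) i.
  apply: qdigit_eventually_periodic => // n.
  by apply: padic_pred_ratE => //; rewrite -cardF; apply: zb.
have [k kP] := lim_periodic T p_prime cardF v_monic v_irr l_gt0 per.
rewrite (gamma_ariE kP).
pose E := algebraic_elements (adjoin (kbar T) [in s]).
have kbarE u : algebraicOver (kv_in T) u -> kv_Cv T u \in E.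
  by move=> ku; apply/asboolP/algebraic_over_mem/sub_adjoinl/kv_Cv_kbar.
have G_high c : (g <= c < l)%N -> G c \in E.
  move=> /andP[gc cl]; apply/asboolP/algebraic_over_mem/sub_adjoinr.
  by apply: map_f; rewrite mem_iota gc (subnKC g_le).
have G0 c : G c != 0 by rewrite fmorph_eq0 (class_lim_neq0 T p_prime cardF).
have G_low c : (c < g)%N -> G c \in E.
  move=> cg; have cl : (c < l)%N := leq_trans cg g_le.
  (* The other indices congruent to [c] modulo [g] are at least [g], so [H] is a product of
     generators, while [G c * H] is the algebraic [G_g(c)]. *)
  pose H := \prod_(r < l | (r %% g == c)%N && (r != Ordinal cl)) G r.
  have HE : H \in E.
    apply: rpred_prod => r /andP[/eqP rg rc]; apply: G_high.
    rewrite ltn_ord andbT leqNgt; apply: contra rc => r_lt.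
    by rewrite -val_eqE /= -rg modn_small.
  have H0 : H != 0 by apply/prodf_neq0.
  have <- : G c * H / H = G c by rewrite mulfK.
  rewrite rpred_div //.
  have -> : G c * H = kv_Cv T (class_lim T g c).
    rewrite -(prod_class_lim T p_prime cardF v_monic v_irr g_gt0 gl l_gt0 cg).
    by rewrite rmorph_prod /= (bigD1 (Ordinal cl)) //= modn_small.
  exact/kbarE/(algebraic_class_lim_gcd T p_prime cardF).
set y' := (X in algebraic_over _ (kv_to_Cv X)).
suff : kv_Cv T y' \in E by move/asboolP.
rewrite rmorphM rpredM //; first exact/kbarE/algebraic_id.
rewrite rmorph_prod rpred_prod // => r _; rewrite rmorphXn rpredX //.
by have [rg|rg] := ltnP r g; [exact: G_low|apply: G_high; rewrite rg ltn_ord].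
Qed.
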